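(* Let $n\ge 2$ and $\alpha\in\mathbb C^n$. The following $S_n$-modules are irreducible cuspidal modules over the $n$-Lie algebra $S^n$: (1) $T(U,\alpha)=t^\alpha\mathcal A_n\otimes U$ with $U=\langle u\rangle$ the one-dimensional trivial $sl_n$-module, under the action $$[x_1,\dots,x_{n-1},t^s\otimes u]=\sum_{i=1}^n(-1)^{n+i}Jac^i_{x_1,\dots,x_{n-1}}d_i(t^s)\otimes u,$$ where $x_1,\dots,x_{n-1}\in\mathcal A_n$ and $s\in\alpha+\mathbb Z^n$; (2) $d(\Omega^0(\alpha))$ under the action $$\Big[x_1,\dots,x_{n-1},\sum_{i=1}^{n}d_i(t^s)\otimes e_i\Big]=\sum_{i=1}^{n}d_i\Big(\sum_{k=1}^{n}(-1)^{n+k}Jac^k_{x_1,\dots,x_{n-1}}d_k(t^s)\Big)\otimes e_i,$$ where $\{e_1,\dots,e_n\}$ is the standard basis of the natural $sl_n$-module and $s\in\alpha+\mathbb Z^n$; (3) the $1$-dimensional trivial module.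
   Context: An $n$-Lie algebra is a vector space with a skew-symmetric $n$-ary bracket satisfying $[x_1,\dots,x_{n-1},[y_1,\dots,y_n]]=\sum_{i=1}^n[y_1,\dots,[x_1,\dots,x_{n-1},y_i],\dots,y_n]$. A module over an $n$-Lie algebra $\mathcal L$ is a vector space $M$ together with an $n$-Lie algebra structure on $\mathcal L\oplus M$ having $\mathcal L$ as a subalgebra and $M$ as an abelian ideal (brackets with at least two arguments in $M$ vanish); it is determined by the expressions $[x_1,\dots,x_{n-1},m]$, the other positions of $m$ being given by skew-symmetry. $\mathcal A_n=\mathbb C[t_1^{\pm1},\dots,t_n^{\pm1}]$, $d_i=t_i\frac{\partial}{\partial t_i}$. $S^n$ is $\mathcal A_n$ with the $n$-ary bracket $\{f_1,\dots,f_n\}=\det(d_i(f_j))_{1\le i,j\le n}$. For $f_1,\dots,f_{n-1}\in\mathcal A_n$, $Jac^k_{f_1,\dots,f_{n-1}}$ is the determinant obtained from this $n\times n$ matrix by deleting its $k$-th row and last column. $S_n$ is the Lie algebra of divergence-zero vector fields, i.e. the subalgebra of $\mathrm{Der}(\mathcal A_n)$ spanned by $D(u,r)=\sum_{i=1}^nu_it^rd_i$ with $u\in\mathbb C^n$, $r\in\mathbb Z^n$ and $\sum_iu_ir_i=0$. The Lie algebra of inner derivations of $S^n$ is identified by the paper with $S_n$ via $ad_{f_1\wedge\dots\wedge f_{n-1}}\mapsto\sum_{k=1}^n(-1)^{n+k}Jac^k_{f_1,\dots,f_{n-1}}d_k$. A weight $S_n$-module is one that is the direct sum of its weight spaces $M_\lambda=\{v:d_iv=\lambda_iv\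 \forall i\}$, $\lambda\in\mathbb C^n$; it is cuspidal if the dimensions of its weight spaces are uniformly bounded. For $\alpha\in\mathbb C^n$, $t^\alpha\mathcal A_n$ has basis $t^s$, $s\in\alpha+\mathbb Z^n$, with $d_j(t^s)=s_jt^s$. For a finite-dimensional simple $sl_n$-module $U$, $T(U,\alpha)=t^\alpha\mathcal A_n\otimes U$ with $S_n$-action $D(u,r)*(t^s\otimes v)=\big(\sum_iu_is_i\big)t^{s+r}\otimes v+\sum_{i,j=1}^nr_iu_jt^{s+r}\otimes E_{i,j}v$ (the matrix $(r_iu_j)_{i,j}$ is traceless). With $V$ the natural $sl_n$-module with standard basis $e_1,\dots,e_n$, $\Omega^k(\alpha)=T(\wedge^kV,\alpha)$ and $d:\Omega^k(\alpha)\to\Omega^{k+1}(\alpha)$ is $d(t^r\otimes v_1\wedge\dots\wedge v_k)=\sum_{i=1}^nd_i(t^r)\otimes e_i\wedge v_1\wedge\dots\wedge v_k$.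
   Formalization: In (1), irreducibility of T(U,α) is asserted only for α not in Z^n: if α is in Z^n, then t^0⊗u is killed by all d_i and spans a proper nonzero submodule. The module and cuspidality claims in (1) are kept for every α. *)

(* Defs.v *)
From HB Require Import structures.
From mathcomp Require Import all_boot all_order all_fingroup all_algebra finmap.
From mathcomp.multinomials Require Import monalg.
From mathcomp Require Import boolp reals complex ring.

Set Implicit Arguments.
Unset Strict Implicit.
Unset Printing Implicit Defensive.

Import Order.TTheory GRing.Theory Num.Theory.
Local Open Scope ring_scope.

(* An n-ary operation on T takes a finite function 'I_n -> T, and its first
   n - 1 arguments form a function 'I_n.-1 -> T. *)

Definition args_rcons (n : nat) (T : Type)
    (x : {ffun 'I_n.-1 -> T}) (y : T) : {ffun 'I_n -> T} :=
  [ffun i : 'I_n => oapp x y (insub (val i))].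

Definition args_set (n : nat) (T : Type)
    (x : {ffun 'I_n -> T}) (i : 'I_n) (y : T) : {ffun 'I_n -> T} :=
  [ffun j => if j == i then y else x j].

Definition multilinear (K : fieldType) (n : nat) (V : lmodType K)
    (br : {ffun 'I_n -> V} -> V) : Prop :=
  forall (x : {ffun 'I_n -> V}) (i : 'I_n) (a : K) (u v : V),
    br (args_set x i (a *: u + v))
      = a *: br (args_set x i u) + br (args_set x i v).

Definition skew_symmetric (K : fieldType) (n : nat) (V : lmodType K)
    (br : {ffun 'I_n -> V} -> V) : Prop :=
  forall (x : {ffun 'I_n -> V}) (s : 'S_n),
    br [ffun i => x (s i)] = (-1) ^+ s *: br x.

Definition is_nLie (K : fieldType) (n : nat) (V : lmodType K)
    (br : {ffun 'I_n -> V} -> V) : Prop :=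
  [/\ multilinear br, skew_symmetric br
    & forall (x : {ffun 'I_n.-1 -> V}) (y : {ffun 'I_n -> V}),
        br (args_rcons x (br y))
          = \sum_(i < n) br (args_set y i (br (args_rcons x (y i))))].

(* [rho x m] is the expression [x_1, ..., x_{n-1}, m]. *)
Definition is_nLie_module (K : fieldType) (n : nat) (L M : lmodType K)
    (br : {ffun 'I_n -> L} -> L) (rho : {ffun 'I_n.-1 -> L} -> M -> M) : Prop :=
  exists brLM : {ffun 'I_n -> L * M} -> (L * M)%type,
    [/\ is_nLie brLM,
        forall x : {ffun 'I_n -> L}, brLM [ffun i => (x i, 0)] = (br x, 0),
        forall (z : {ffun 'I_n -> L * M}) (i : 'I_n),
          (z i).1 = 0 -> (brLM z).1 = 0,
        forall (z : {ffun 'I_n -> L * M}) (i j : 'I_n),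
          i != j -> (z i).1 = 0 -> (z j).1 = 0 -> brLM z = 0
      & forall (x : {ffun 'I_n.-1 -> L}) (m : M),
          brLM (args_rcons [ffun i => (x i, 0)] (0, m)) = (0, rho x m)].

Definition is_nLie_submodule (K : fieldType) (n : nat) (L M : lmodType K)
    (rho : {ffun 'I_n.-1 -> L} -> M -> M) (N : M -> Prop) : Prop :=
  [/\ N 0, forall (a : K) (u v : M), N u -> N v -> N (a *: u + v)
    & forall (x : {ffun 'I_n.-1 -> L}) (m : M), N m -> N (rho x m)].

Definition nLie_irreducible (K : fieldType) (n : nat) (L M : lmodType K)
    (rho : {ffun 'I_n.-1 -> L} -> M -> M) : Prop :=
  (exists m : M, m != 0) /\
  forall N : M -> Prop, is_nLie_submodule rho N ->
    (forall m, N m -> m = 0) \/ (forall m, N m).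

(* The finitely supported function on Z^n with value v at k and 0 elsewhere.
   It is locked, like the operations below, because unification is very slow
   once it unfolds down to monalg and to the structures on 'rV[int]_n. *)
HB.lock Definition mono (n : nat) (U : zmodType) (k : 'rV[int]_n) (v : U) :
    {malg U['rV[int]_n]} :=
  << v *g k >>.

Section Mono.
Variables (n : nat) (U : zmodType).
Implicit Types (w : {malg U['rV[int]_n]}) (k l : 'rV[int]_n) (v : U).

Lemma monoE k v l : (mono k v)@_l = v *+ (k == l).
Proof. by rewrite mono.unlock mcoeffU. Qed.

Lemma monoD k u v : mono k (u + v) = mono k u + mono k v.
Proof. by rewrite mono.unlock monalgUD. Qed.

Lemma mono0 k : mono k (0 : U) = 0.
Proof. by rewrite mono.unlock monalgU0. Qed.

Lemma mono_sum (I : Type) (r : seq I) (F : I -> U) k :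
  mono k (\sum_(i <- r) F i) = \sum_(i <- r) mono k (F i).
Proof. exact: (big_morph (mono k) (monoD k) (mono0 k)). Qed.

Lemma mono_msupp k v :
  msupp (mono k v) = if v == 0 then fset0 else [fset k]%fset.
Proof. by rewrite mono.unlock msuppU. Qed.

Lemma mono_msupp_le k v : (msupp (mono k v) `<=` [fset k])%fset.
Proof. by rewrite mono.unlock msuppU_le. Qed.

Lemma mono_sumE w : w = \sum_(k <- msupp w) mono k w@_k.
Proof. by rewrite mono.unlock -monalgE. Qed.

End Mono.

(* The Laurent polynomial algebra, as the group algebra of Z^n: f@_k is the
   coefficient of t^k.  The ring structure that monalg puts on {malg K[M]}
   is only available for monoids M without nontrivial units, hence the
   definition of the product below. *)
Definition laurent (K : fieldType) (n : nat) := {malg K['rV[int]_n]}.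

HB.instance Definition _ (K : fieldType) (n : nat) :=
  GRing.Zmodule.on (laurent K n).

Definition tpow (K : fieldType) (n : nat) (k : 'rV[int]_n) : laurent K n :=
  mono k 1.

HB.lock Definition lscale (K : fieldType) (n : nat) (a : K) (f : laurent K n) :
    laurent K n :=
  [malg k in msupp f => a * f@_k].

HB.lock Definition lmul (K : fieldType) (n : nat) (f g : laurent K n) :
    laurent K n :=
  \sum_(k <- msupp f) \sum_(l <- msupp g) mono (k + l) (f@_k * g@_l).

Section LaurentRing.
Variables (K : fieldType) (n : nat).
Local Notation laurent := (laurent K n).
Local Notation tpow := (tpow K).
Implicit Types f g h : laurent.

Lemma lscaleE (a : K) f k : (lscale a f)@_k = a * f@_k.
Proof.
by rewrite lscale.unlock mcoeffE; case: msuppP => // _; rewrite mulr0.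
Qed.

Lemma lscaleA (a b : K) f : lscale a (lscale b f) = lscale (a * b) f.
Proof. by apply/malgP => k; rewrite 3!lscaleE mulrA. Qed.

Lemma lscale1 : left_id 1 (@lscale K n).
Proof. by move=> f; apply/malgP => k; rewrite lscaleE mul1r. Qed.

Lemma lscaleDr : right_distributive (@lscale K n) +%R.
Proof.
by move=> a f g; apply/malgP => k; rewrite lscaleE !mcoeffD 2!lscaleE mulrDr.
Qed.

Lemma lscaleDl f : {morph (@lscale K n)^~ f : a b / a + b}.
Proof.
by move=> a b; apply/malgP => k; rewrite lscaleE mcoeffD 2!lscaleE mulrDl.
Qed.

HB.instance Definition _ := GRing.Zmodule_isLmodule.Build K laurent
  lscaleA lscale1 lscaleDr lscaleDl.

Lemma lmulw (d1 d2 : {fset 'rV[int]_n}) f g :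
  (msupp f `<=` d1)%fset -> (msupp g `<=` d2)%fset ->
  lmul f g = \sum_(k <- d1) \sum_(l <- d2) mono (k + l) (f@_k * g@_l).
Proof.
move=> le1 le2; rewrite lmul.unlock (big_fset_incl _ le1) /=.
  apply: eq_bigr => k _; apply: big_fset_incl => // l _ /mcoeff_outdom ->.
  by rewrite mulr0 mono0.
move=> k _ /mcoeff_outdom fk; rewrite big1 // => l _.
by rewrite fk mul0r mono0.
Qed.

Lemma lmulC : commutative (@lmul K n).
Proof.
move=> f g; rewrite lmul.unlock exchange_big /=; apply: eq_bigr => k _.
by apply: eq_bigr => l _; rewrite mulrC addrC.
Qed.

Lemma lmulDl : left_distributive (@lmul K n) +%R.
Proof.
move=> f g h.
rewrite (lmulw (msuppD_le f g) (fsubset_refl _)).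
rewrite (lmulw (fsubsetUl (msupp f) (msupp g)) (fsubset_refl _)).
rewrite (lmulw (fsubsetUr (msupp f) (msupp g)) (fsubset_refl _)).
rewrite -big_split /=; apply: eq_bigr => k _.
rewrite -big_split /=; apply: eq_bigr => l _.
by rewrite mcoeffD mulrDl monoD.
Qed.

Lemma lmulDr : right_distributive (@lmul K n) +%R.
Proof. by move=> f g h; rewrite lmulC lmulDl !(lmulC f). Qed.

Lemma lmul0l : left_zero 0 (@lmul K n).
Proof. by move=> f; rewrite lmul.unlock msupp0 big_seq_fset0. Qed.

Lemma lmul0r : right_zero 0 (@lmul K n).
Proof. by move=> f; rewrite lmulC lmul0l. Qed.

Lemma lmulUU (a b : K) (k l : 'rV[int]_n) :
  lmul (mono k a) (mono l b) = mono (k + l) (a * b).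
Proof.
rewrite (lmulw (mono_msupp_le k a) (mono_msupp_le l b)) !big_seq_fset1.
by rewrite 2!monoE !eqxx.
Qed.

Lemma lmul_suml (I : Type) (r : seq I) (F : I -> laurent) g :
  lmul (\sum_(i <- r) F i) g = \sum_(i <- r) lmul (F i) g.
Proof.
elim: r => [|i r IHr]; first by rewrite !big_nil lmul0l.
by rewrite !big_cons lmulDl IHr.
Qed.

Lemma lmul_sumr (I : Type) (r : seq I) (F : I -> laurent) g :
  lmul g (\sum_(i <- r) F i) = \sum_(i <- r) lmul g (F i).
Proof. by rewrite lmulC lmul_suml; apply: eq_bigr => i _; rewrite lmulC. Qed.

Lemma lmulA : associative (@lmul K n).
Proof.
move=> f g h; rewrite [f]mono_sumE.
rewrite (lmul_suml _ _ (lmul g h)) (lmul_suml _ _ g) (lmul_suml _ _ h).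
apply: eq_bigr => k _; rewrite [g]mono_sumE.
rewrite (lmul_suml _ _ h) !(lmul_sumr _ _ (mono k f@_k)) (lmul_suml _ _ h).
apply: eq_bigr => l _; rewrite [h]mono_sumE.
rewrite (lmul_sumr _ _ (mono l g@_l)) (lmul_sumr _ _ (mono k f@_k)).
rewrite (lmul_sumr _ _ (lmul (mono k f@_k) (mono l g@_l))).
by apply: eq_bigr => p _; rewrite !lmulUU mulrA addrA.
Qed.

Lemma lmul1l : left_id (tpow 0) (@lmul K n).
Proof.
move=> f; rewrite [f in LHS]mono_sumE [RHS]mono_sumE lmul_sumr.
by apply: eq_bigr => k _; rewrite lmulUU mul1r add0r.
Qed.

Lemma tpow0_neq0 : (tpow 0 : laurent) != 0.
Proof.
apply/eqP => /(congr1 (mcoeff 0))/eqP.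
by rewrite monoE eqxx mcoeff0 oner_eq0.
Qed.

HB.instance Definition _ := GRing.Zmodule_isComNzRing.Build laurent
  lmulA lmulC lmul1l lmulDl tpow0_neq0.

Lemma laurent_scalerAl (a : K) f g : a *: (f * g) = (a *: f) * g.
Proof.
have le_af : (msupp (a *: f) `<=` msupp f)%fset.
  apply/fsubsetP => k; rewrite -!mcoeff_neq0 lscaleE.
  by apply: contra_neq => ->; rewrite mulr0.
rewrite [f * g](lmulw (fsubset_refl _) (fsubset_refl _)).
rewrite [RHS](lmulw le_af (fsubset_refl _)).
rewrite scaler_sumr; apply: eq_bigr => k _.
rewrite scaler_sumr; apply: eq_bigr => l _.
apply/malgP => p; rewrite lscaleE 2!monoE lscaleE.
by rewrite -mulrA mulrnAr.
Qed.

HB.instance Definition _ := GRing.Lmodule_isLalgebra.Build K laurent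
  laurent_scalerAl.
HB.instance Definition _ := GRing.Lalgebra_isComAlgebra.Build K laurent.

End LaurentRing.

(* t^alpha A_n is identified with A_n through t^alpha f <-> f, so that
   [tpow k] stands for t^(alpha + k), the A_n-module structure is the product
   of A_n, and d_j (t^(alpha + k)) = (alpha_j + k_j) t^(alpha + k).
   The case alpha = 0 is A_n itself with d_j = t_j d/dt_j. *)

Definition wt (K : fieldType) (n : nat) (alpha : 'rV[K]_n) (k : 'rV[int]_n) :
    'rV[K]_n :=
  alpha + map_mx intr k.

HB.lock Definition tder (K : fieldType) (n : nat) (alpha : 'rV[K]_n)
    (j : 'I_n) (f : laurent K n) : laurent K n :=
  \sum_(k <- msupp f) mono k (wt alpha k 0 j * f@_k).

Section VectorFields.
Variables (K : fieldType) (n : nat).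
Local Notation laurent := (laurent K n).
Local Notation tpow := (tpow K).

Definition dlog (j : 'I_n) (f : laurent) : laurent := tder 0 j f.

Definition jac_bracket (f : {ffun 'I_n -> laurent}) : laurent :=
  \det (\matrix_(i, j) dlog i (f j)).

Definition Jac (k : 'I_n) (f : {ffun 'I_n.-1 -> laurent}) : laurent :=
  \det (row' k (\matrix_(i < n, j < n.-1) dlog i (f j))).

(* The vector field X stands for \sum_k X_k d_k. *)
Definition vfield := {ffun 'I_n -> laurent}.

Definition vf_lie (X Y : vfield) : vfield :=
  [ffun j => \sum_i (X i * dlog i (Y j) - Y i * dlog i (X j))].

Definition Dvf (u : 'rV[K]_n) (r : 'rV[int]_n) : vfield :=
  [ffun i => u 0 i *: tpow r].

Definition in_Sn (X : vfield) : Prop :=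
  exists s : seq ('rV[K]_n * 'rV[int]_n),
    (forall p, p \in s -> \sum_i p.1 0 i * (p.2 0 i)%:~R = 0) /\
    X = \sum_(p <- s) Dvf p.1 p.2.

(* The index k : 'I_n starts at 0. *)
Definition ad_vf (f : {ffun 'I_n.-1 -> laurent}) : vfield :=
  [ffun k : 'I_n => (-1) ^+ (n + k.+1) * Jac k f].

(* An S_n-action is given on all vector fields; only its restriction to S_n
   matters. *)

Definition is_Sn_module (M : lmodType K) (act : vfield -> M -> M) : Prop :=
  [/\ forall X (a : K) (u v : M), in_Sn X ->
        act X (a *: u + v) = a *: act X u + act X v,
      forall X Y (a : K) (v : M), in_Sn X -> in_Sn Y ->
        act (a *: X + Y) v = a *: act X v + act Y v
    & forall X Y (v : M), in_Sn X -> in_Sn Y ->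
        act (vf_lie X Y) v = act X (act Y v) - act Y (act X v)].

Definition weight_vector (M : lmodType K) (act : vfield -> M -> M)
    (la : 'rV[K]_n) (v : M) : Prop :=
  forall i : 'I_n, act (Dvf (delta_mx 0 i) 0) v = la 0 i *: v.

Definition is_weight_module (M : lmodType K) (act : vfield -> M -> M) : Prop :=
  (forall v : M, exists (s : seq 'rV[K]_n) (c : 'rV[K]_n -> M),
     (forall la, weight_vector act la (c la)) /\ v = \sum_(la <- s) c la) /\
  (forall (s : seq 'rV[K]_n) (c : 'rV[K]_n -> M), uniq s ->
     (forall la, weight_vector act la (c la)) ->
     \sum_(la <- s) c la = 0 -> forall la, la \in s -> c la = 0).

(* dim M_la <= N is expressed by a family of N vectors spanning M_la. *)
Definition is_cuspidal (M : lmodType K) (act : vfield -> M -> M) : Prop :=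
  is_weight_module act /\
  exists N : nat, forall la : 'rV[K]_n, exists e : 'I_N -> M,
    (forall i, weight_vector act la (e i)) /\
    forall v, weight_vector act la v ->
      exists c : 'I_N -> K, v = \sum_i c i *: e i.

(* The S_n-module (M, act) is a module over the n-Lie algebra S^n under rho,
   the inner derivation ad_{x_1 ^ ... ^ x_{n-1}} being identified with
   [ad_vf x]. *)
Definition is_Sn_nLie_module (M : lmodType K) (act : vfield -> M -> M)
    (rho : {ffun 'I_n.-1 -> laurent} -> M -> M) : Prop :=
  [/\ is_Sn_module act, is_nLie_module jac_bracket rho
    & forall x m, rho x m = act (ad_vf x) m].

End VectorFields.

(* Only the values of the action on traceless matrices matter. *)

Record sl_module (K : fieldType) (n : nat) (U : lmodType K) := SlModule {
  sl_act :> 'M[K]_n -> U -> U;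
  sl_actDr : forall A (a : K) u v, \tr A = 0 ->
    sl_act A (a *: u + v) = a *: sl_act A u + sl_act A v;
  sl_actDl : forall A B (a : K) u, \tr A = 0 -> \tr B = 0 ->
    sl_act (a *: A + B) u = a *: sl_act A u + sl_act B u;
  sl_act_lie : forall A B u, \tr A = 0 -> \tr B = 0 ->
    sl_act (A *m B - B *m A) u = sl_act A (sl_act B u) - sl_act B (sl_act A u)
}.

Definition sl_trivial (K : fieldType) (n : nat) (U : lmodType K) :
  sl_module n U.
Proof.
exists (fun _ _ => 0).
- by move=> *; rewrite scaler0 addr0.
- by move=> *; rewrite scaler0 addr0.
- by move=> *; rewrite subr0.
Defined.

Definition sl_natural (K : fieldType) (n : nat) : sl_module n 'cV[K]_n.
Proof.
exists (fun A v => A *m v).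
- by move=> A a u v _; rewrite mulmxDr scalemxAr.
- by move=> A B a u _ _; rewrite mulmxDl scalemxAl.
- by move=> A B u _ _; rewrite mulmxBl !mulmxA.
Defined.

(* t^alpha A_n (x) U, as the finitely supported functions from Z^n to U: the
   coefficient w@_k = v corresponds to the term t^(alpha + k) (x) v. *)

Definition tmod (K : fieldType) (n : nat) (U : lmodType K) :=
  {malg U['rV[int]_n]}.

HB.instance Definition _ (K : fieldType) (n : nat) (U : lmodType K) :=
  GRing.Zmodule.on (tmod n U).

HB.lock Definition tmod_scale (K : fieldType) (n : nat) (U : lmodType K)
    (a : K) (w : tmod n U) : tmod n U :=
  [malg k in msupp w => a *: w@_k].

Section TModule.
Variables (K : fieldType) (n : nat) (U : lmodType K).
Implicit Types w : tmod n U.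

Lemma tmod_scaleE a w k : (tmod_scale a w)@_k = a *: w@_k.
Proof.
by rewrite tmod_scale.unlock mcoeffE; case: msuppP => // _; rewrite scaler0.
Qed.

Lemma tmod_scaleA a b w : tmod_scale a (tmod_scale b w) = tmod_scale (a * b) w.
Proof. by apply/malgP => k; rewrite 3!tmod_scaleE scalerA. Qed.

Lemma tmod_scale1 : left_id 1 (@tmod_scale K n U).
Proof. by move=> w; apply/malgP => k; rewrite tmod_scaleE scale1r. Qed.

Lemma tmod_scaleDr : right_distributive (@tmod_scale K n U) +%R.
Proof.
move=> a w w'; apply/malgP => k.
by rewrite tmod_scaleE !mcoeffD 2!tmod_scaleE scalerDr.
Qed.

Lemma tmod_scaleDl w : {morph (@tmod_scale K n U)^~ w : a b / a + b}.
Proof.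
move=> a b; apply/malgP => k.
by rewrite tmod_scaleE mcoeffD 2!tmod_scaleE scalerDl.
Qed.

HB.instance Definition _ := GRing.Zmodule_isLmodule.Build K (tmod n U)
  tmod_scaleA tmod_scale1 tmod_scaleDr tmod_scaleDl.

End TModule.

HB.lock Definition tens (K : fieldType) (n : nat) (U : lmodType K)
    (f : laurent K n) (v : U) : tmod n U :=
  \sum_(k <- msupp f) mono k (f@_k *: v).

(* X = \sum_r D(u_r, r) with (u_r)_j = (X j)@_r, where r ranges over the
   union of the supports of the coordinates of X.  The entry (i, j) of the
   matrix below is r_i (u_r)_j. *)
Definition vf_supp (K : fieldType) (n : nat) (X : vfield K n) :
    {fset 'rV[int]_n} :=
  (\bigcup_(j <- enum 'I_n) msupp (X j))%fset.

HB.lock Definition T_act (K : fieldType) (n : nat) (U : lmodType K)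
    (rho : sl_module n U) (alpha : 'rV[K]_n) (X : vfield K n) (w : tmod n U) :
    tmod n U :=
  \sum_(r <- vf_supp X) \sum_(k <- msupp w)
    mono (k + r)
      ((\sum_i (X i)@_r * wt alpha k 0 i) *: w@_k
       + rho (\matrix_(i, j) ((r 0 i)%:~R * (X j)@_r)) w@_k).

(* Omega^0(alpha) = T(K, alpha) and Omega^1(alpha) = T(V, alpha), where
   V = 'cV[K]_n has the standard basis e_i = [delta_mx i 0].  In degree 0,
   d (t^s (x) c) = \sum_i d_i (t^s) (x) c e_i. *)

Definition Omega0 (K : fieldType) (n : nat) := tmod n K^o.
HB.instance Definition _ (K : fieldType) (n : nat) :=
  GRing.Lmodule.on (Omega0 K n).

Definition Omega1 (K : fieldType) (n : nat) := tmod n 'cV[K]_n.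
HB.instance Definition _ (K : fieldType) (n : nat) :=
  GRing.Lmodule.on (Omega1 K n).

HB.lock Definition ddR (K : fieldType) (n : nat) (alpha : 'rV[K]_n)
    (w : Omega0 K n) : Omega1 K n :=
  \sum_(k <- msupp w) \sum_(i < n)
    tens (tder alpha i (tpow K k)) ((w@_k : K) *: delta_mx i 0).

Section DeRham.
Variables (K : fieldType) (n : nat) (alpha : 'rV[K]_n).
Local Notation Omega0 := (Omega0 K n).
Local Notation Omega1 := (Omega1 K n).
Local Notation ddR := (ddR alpha).

Lemma tens_tpow (U : lmodType K) (i : 'I_n) k (v : U) :
  tens (tder alpha i (tpow K k)) v = mono k (wt alpha k 0 i *: v).
Proof.
rewrite tder.unlock tens.unlock /tpow mono_msupp oner_eq0 big_seq_fset1.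
rewrite monoE eqxx mulr1 mono_msupp.
case: eqP => [->|_]; first by rewrite big_seq_fset0 scale0r mono0.
by rewrite big_seq_fset1 monoE eqxx.
Qed.

Lemma ddR_sumE (w : Omega0) :
  ddR w = \sum_(k <- msupp w) mono k ((w@_k : K) *: (wt alpha k)^T).
Proof.
rewrite ddR.unlock; apply: eq_bigr => k _.
rewrite (eq_bigr _ (fun i _ => tens_tpow i k _)).
rewrite -mono_sum; congr (mono k _); apply/colP => j.
rewrite summxE (bigD1 j) //= big1 => [|i /negbTE ij]; rewrite !mxE ?eqxx.
  by rewrite addr0 mulr1 mulrC.
by rewrite eq_sym ij !mulr0.
Qed.

Lemma ddR_coef (w : Omega0) k : (ddR w)@_k = (w@_k : K) *: (wt alpha k)^T.
Proof.
rewrite ddR_sumE raddf_sum /=.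
under eq_bigr do rewrite monoE.
have [kw|kw] := boolP (k \in msupp w).
  rewrite (big_fsetD1 k) //= eqxx big1_fset ?addr0 // => l.
  by rewrite in_fsetD1 => /andP[/negbTE-> _].
rewrite big1_fset ?(mcoeff_outdom kw) ?scale0r // => l lw _.
by case: eqP kw => // <-; rewrite lw.
Qed.

Lemma ddR_linear : linear ddR.
Proof.
move=> a u v; apply/malgP => k.
by rewrite mcoeffD tmod_scaleE 3!ddR_coef mcoeffD tmod_scaleE scalerDl scalerA.
Qed.

Definition in_ddR : {pred Omega1} := fun w => `[< exists f, w = ddR f >].

Lemma in_ddR_submod : submod_closed in_ddR.
Proof.
split=> [|a _ _ /asboolP[f ->] /asboolP[g ->]]; apply/asboolP.
  by exists 0; rewrite ddR.unlock msupp0 big_seq_fset0.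
by exists (a *: f + g); rewrite ddR_linear.
Qed.

HB.instance Definition _ := GRing.isSubmodClosed.Build K Omega1 in_ddR
  in_ddR_submod.

Definition ddR_image := {w : Omega1 | w \in in_ddR}.
HB.instance Definition _ := SubChoice.on ddR_image.
HB.instance Definition _ := [SubChoice_isSubLmodule of ddR_image by <:].

Lemma T_act_ddR (X : vfield K n) (f : Omega0) :
  exists g, T_act (sl_natural K n) alpha X (ddR f) = ddR g.
Proof.
pose s r k : K := \sum_i (X i)@_r * wt alpha k 0 i.
pose g : Omega0 :=
  \sum_(r <- vf_supp X) \sum_(k <- msupp f) mono (k + r) (s r k * f@_k).
have ddR0 : ddR 0 = 0 by rewrite ddR.unlock msupp0 big_seq_fset0.
have ddRD : {morph ddR : u v / u + v}.
  by move=> u v; rewrite -{1}[u]scale1r ddR_linear scale1r.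
exists g; rewrite T_act.unlock (big_morph ddR ddRD ddR0); apply: eq_bigr => r _.
rewrite (big_morph ddR ddRD ddR0).
rewrite (@big_fset_incl _ _ _ _ _ (msupp f)) /=; first last.
- by move=> k _ /mcoeff_outdom->; rewrite scaler0 mulmx0 addr0 mono0.
- apply/fsubsetP => k; rewrite -!mcoeff_neq0 ddR_coef.
  by apply: contra_neq => ->; rewrite scale0r.
apply: eq_bigr => k _; rewrite ddR_coef; apply/malgP => l.
rewrite ddR_coef 2!monoE; case: eqP => [<-|_]; last by rewrite scale0r.
apply/colP => i; rewrite !mxE -/(s r k) /=.
under eq_bigr do rewrite !mxE.
rewrite [X in _ + X](_ : _ = (r 0 i)%:~R * (f@_k * s r k)).
  by rewrite rmorphD /= mulrA; ring.
rewrite /s 2!mulr_sumr; apply: eq_bigr => j _; rewrite !mxE; ring.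
Qed.

Definition ddR_act (X : vfield K n) (w : ddR_image) : ddR_image.
Proof.
exists (T_act (sl_natural K n) alpha X (val w)).
abstract (by case: w => w /= /asboolP[f ->]; apply/asboolP; apply: T_act_ddR).
Defined.

End DeRham.

Definition integral (K : fieldType) (n : nat) (alpha : 'rV[K]_n) : Prop :=
  exists z : 'rV[int]_n, alpha = map_mx intr z.

(* Main.v *)
Require Import Defs.
From HB Require Import structures.
From mathcomp Require Import all_boot all_order all_fingroup all_algebra finmap.
From mathcomp.multinomials Require Import monalg.
From mathcomp Require Import boolp reals complex ring.

Set Implicit Arguments.
Unset Strict Implicit.
Unset Printing Implicit Defensive.

Import Order.TTheory GRing.Theory Num.Theory.
Local Open Scope ring_scope.

(** The Jacobian bracket of commuting derivations [D_1, ..., D_n] of a commutative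
    ring is an n-Lie bracket.  An inner derivation is a vector field
    [X = \sum_k c_k D_k] whose coefficients are the cofactors of a Jacobian
    matrix along one column, and such fields have zero divergence
    ([divergence_cofactor]).  Comparing [X (det (D_a y_b))] with the sum of the
    brackets of the [y_b] in which one [y_b] is replaced by [X y_b], the
    difference is the divergence of [X] times the bracket
    ([jacobian_fundamental_identity]).

    The twist [t^alpha A_n] becomes a module by the same identity, applied to
    the square-zero extension [A_n + t^alpha A_n] and its derivations [d_i].
    The bracket involves its arguments only through their derivatives, so it
    descends to quotients of [t^alpha A_n] by elements that all [d_i] kill
    ([jacobian_module]).  Both nontrivial modules arise in this way:
    [t^alpha A_n (x) U] is a copy of [t^alpha A_n], and [d (Omega^0)] is its
    quotient by the kernel of [d].  The vector fields act on both as on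
    [t^alpha A_n] ([T_act_weighted]), and each weight space is spanned by the
    image of at most one monomial ([covered_cuspidal]).

    For irreducibility, write [b] for the weight of [t^k].  Inner derivations by
    monomials provide, up to sign, the operators
    [t^k |-> (r_i b_j - r_j b_i) t^(k + r)] ([ex_inner_monomial]).  The
    composite of those for [r] and [- r] is diagonal, with eigenvalue
    [(r_i b_j - r_j b_i)^2] up to sign, and these squares determine [b] up to
    sign ([minor2_separation]).  Hence an element of a submodule can be reduced to
    two monomials of opposite weights; one more shift makes these weights
    separable, which yields a single monomial ([submodule_monomial]).  From it
    at most two shifts lead to every other monomial of nonzero weight
    ([submodule_transitive]).  A monomial of weight zero is absent from the
    first module when [alpha] is not integral, and is zero in the second. *)

(** * The fundamental identity for Jacobians of commuting derivations *)

Lemma alternating_sum0 (A : pzRingType) (n : nat) (t : 'S_n) (F : 'S_n -> A) :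
  odd_perm t -> (forall s, F (t * s)%g = F s) ->
  \sum_(s : 'S_n) (-1) ^+ s * F s = 0.
Proof.
move=> t_odd Ft; have oddMt s : (t * s)%g = ~~ s :> bool.
  by rewrite odd_permM t_odd.
rewrite (bigID (@odd_perm _)) /=; apply: canLR (subrK _) _.
rewrite add0r -sumrN.
rewrite (reindex_inj (mulgI t)); apply: eq_big => //= s.
by rewrite oddMt => /negPf->; rewrite Ft mulN1r mul1r.
Qed.

(** Expanding along the replaced columns pairs [C *m Y] with the adjugate of
    [Y]: this is Jacobi's formula for the derivative of the determinant at [Y]
    in the direction [C *m Y]. *)
Lemma sum_det_set_col (A : comNzRingType) (n : nat) (C Y : 'M[A]_n) :
  \sum_b \det (\matrix_(i, j) (if j == b then (C *m Y) i j else Y i j))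
    = \tr C * \det Y.
Proof.
have -> : \tr C * \det Y = \tr (C *m Y *m \adj Y).
  by rewrite -mulmxA mul_mx_adj mul_mx_scalar mxtraceZ mulrC.
rewrite mxtrace_mulC /mxtrace; apply: eq_bigr => b _.
rewrite (expand_det_col _ b) mxE; apply: eq_bigr => a _.
rewrite !mxE eqxx mulrC; congr (_ * _); rewrite /cofactor; congr (_ * \det _).
by apply/matrixP => i j; rewrite !mxE eq_sym (negPf (neq_lift b j)).
Qed.

Definition derivation (A : comNzRingType) (d : A -> A) : Prop :=
  {morph d : x y / x + y} /\ forall x y, d (x * y) = d x * y + x * d y.

Section Derivation.
Variables (A : comNzRingType) (d : A -> A).
Hypothesis d_der : derivation d.

Lemma derivation0 : d 0 = 0.
Proof. by apply: (@addrI _ (d 0)); rewrite -d_der.1 !addr0. Qed.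

Lemma derivation_sum (I : Type) (r : seq I) (P : pred I) (F : I -> A) :
  d (\sum_(i <- r | P i) F i) = \sum_(i <- r | P i) d (F i).
Proof. exact: (big_morph d d_der.1 derivation0). Qed.

Lemma derivation1 : d 1 = 0.
Proof.
by apply: (@addrI _ (d 1)); rewrite -{3}[1]mulr1 d_der.2 mulr1 mul1r addr0.
Qed.

Lemma derivation_opp x : d (- x) = - d x.
Proof. by apply: (@addrI _ (d x)); rewrite -d_der.1 !subrr derivation0. Qed.

Lemma derivation_sign (b : bool) x : d ((-1) ^+ b * x) = (-1) ^+ b * d x.
Proof. by case: b; rewrite ?mulN1r ?mul1r ?derivation_opp. Qed.

Lemma derivation_prod (I : finType) (P : pred I) (F : I -> A) :
  d (\prod_(i | P i) F i)
    = \sum_(i | P i) d (F i) * \prod_(j | P j && (j != i)) F j.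
Proof.
suff gen r : uniq r -> d (\prod_(i <- r | P i) F i)
    = \sum_(i <- r | P i) d (F i) * \prod_(j <- r | P j && (j != i)) F j.
  by rewrite gen // /index_enum -enumT enum_uniq.
elim: r => [|x r IHr] /= => [|/andP[xr ur]].
  by rewrite !big_nil derivation1.
rewrite !big_cons; case: ifP => Px; last first.
  by rewrite IHr //; apply: eq_bigr => i Pi; rewrite big_cons Px.
rewrite d_der.2 IHr // eqxx andbF; congr (_ * _ + _).
  rewrite [RHS]big_seq_cond [LHS]big_seq_cond; apply: eq_bigl => j.
  by case: eqP => [->|_]; rewrite ?(negPf xr) // andbT.
rewrite mulr_sumr [RHS]big_seq_cond [LHS]big_seq_cond; apply: eq_bigr => i.
move=> /andP[ir _]; rewrite big_cons Px /=.
by case: eqP xr => [->|_ _]; rewrite ?ir // mulrCA.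
Qed.

Lemma derivation_det (n : nat) (Y : 'M[A]_n) :
  d (\det Y)
    = \sum_b \det (\matrix_(i, j) (if j == b then d (Y i j) else Y i j)).
Proof.
rewrite -[in LHS]det_tr derivation_sum.
under eq_bigr => s _ do rewrite derivation_sign derivation_prod mulr_sumr.
rewrite exchange_big /=; apply: eq_bigr => b _.
rewrite -det_tr; apply: eq_bigr => s _; rewrite [in RHS](bigD1 b) //= !mxE eqxx.
by congr (_ * (_ * _)); apply: eq_bigr => j /negPf jb; rewrite !mxE jb.
Qed.

End Derivation.

Section Arguments.
Variables (n : nat) (T : Type).

Lemma args_rcons_max (x : {ffun 'I_n.+1.-1 -> T}) (y : T) :
  args_rcons x y ord_max = y.
Proof. by rewrite ffunE insubF //= ltnn. Qed.

Lemma args_rcons_lift (x : {ffun 'I_n.+1.-1 -> T}) (y : T) (j : 'I_n) :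
  args_rcons x y (lift ord_max j) = x j.
Proof.
by rewrite ffunE (lift_max j : val _ = val j) valK.
Qed.

End Arguments.

Lemma args_rcons_ind (n : nat) (T T' : Type) (P : T -> T' -> Prop)
    (x : {ffun 'I_n.+1.-1 -> T}) (x' : {ffun 'I_n.+1.-1 -> T'})
    (y : T) (y' : T') :
  (forall j, P (x j) (x' j)) -> P y y' ->
  forall j, P (args_rcons x y j) (args_rcons x' y' j).
Proof.
move=> Px Py j; case: (unliftP ord_max j) => [j' ->|->].
  by rewrite !args_rcons_lift.
by rewrite !args_rcons_max.
Qed.

Section Jacobian.
Variables (A : comNzRingType) (n : nat) (D : 'I_n -> A -> A).
Hypothesis D_der : forall i, derivation (D i).
Hypothesis D_comm : forall i j x, D i (D j x) = D j (D i x).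

Definition jacobian_mx (f : 'I_n -> A) : 'M[A]_n := \matrix_(i, j) D i (f j).

(** The cofactors of a Jacobian matrix along one column form a field of zero
    divergence.  After Leibniz expansion the divergence is an alternating sum
    of terms that contain one second derivative [D_(s c) D_(s b) f_b], and
    exchanging the values of [s] at [b] and [c] preserves that term since the
    derivations commute. *)
Lemma divergence_cofactor (f : 'I_n -> A) (c : 'I_n) :
  \sum_k D k (cofactor (jacobian_mx f) k c) = 0.
Proof.
pose G (s : 'S_n) b :=
  D (s c) (D (s b) (f b)) * \prod_(j | (c != j) && (j != b)) D (s j) (f j).
have cofE k : D k (cofactor (jacobian_mx f) k c)
    = \sum_(s : 'S_n | s c == k) \sum_(b | c != b) (-1) ^+ s * G s b.
  rewrite -cofactor_tr expand_cofactor derivation_sum //.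
  apply: eq_bigr => s /eqP <-; rewrite derivation_sign // derivation_prod //.
  rewrite mulr_sumr; apply: eq_bigr => b _; rewrite !mxE; congr (_ * (_ * _)).
  by apply: eq_bigr => j _; rewrite !mxE.
transitivity (\sum_(s : 'S_n) \sum_(b | c != b) (-1) ^+ s * G s b).
  rewrite [RHS](partition_big (fun s : 'S_n => s c) xpredT) //=.
  by apply: eq_bigr => k _; rewrite cofE.
rewrite exchange_big /= big1 // => b cb.
apply: (alternating_sum0 (t := tperm b c)); first by rewrite odd_tperm eq_sym.
move=> s; rewrite /G !permM tpermL tpermR D_comm; congr (_ * _).
apply: eq_bigr => j /andP[cj jb]; rewrite permM.
by rewrite tpermD // eq_sym.
Qed.

Lemma eq_jacobian_mx (f g : 'I_n -> A) :
  (forall i j, D i (f j) = D i (g j)) -> jacobian_mx f = jacobian_mx g.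
Proof. by move=> fg; apply/matrixP => i j; rewrite !mxE. Qed.

Lemma det_jacobian_args_set (f : {ffun 'I_n -> A}) (b : 'I_n) (u : A) :
  \det (jacobian_mx (args_set f b u))
    = \det (\matrix_(i, j) (if j == b then D i u else D i (f j))).
Proof.
by congr (\det _); apply/matrixP => i j; rewrite !mxE ffunE; case: eqP.
Qed.

End Jacobian.

Section FundamentalIdentity.
Variables (A : comNzRingType) (n : nat) (D : 'I_n.+1 -> A -> A).
Hypothesis D_der : forall i, derivation (D i).
Hypothesis D_comm : forall i j x, D i (D j x) = D j (D i x).
Implicit Types (x : {ffun 'I_n.+1.-1 -> A}) (y : {ffun 'I_n.+1 -> A}).

(** The coefficients of the vector field that represents the inner derivation
    of [x].  The last argument is set to an arbitrary value, here 0: taking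
    cofactors along the last column deletes it. *)
Definition inner_field x (k : 'I_n.+1) : A :=
  cofactor (jacobian_mx D (args_rcons x 0)) k ord_max.

Lemma inner_fieldE x k :
  inner_field x k
    = (-1) ^+ (n.+1 + k.+1)
      * \det (row' k (\matrix_(i < n.+1, j < n.+1.-1) D i (x j))).
Proof.
rewrite /inner_field /cofactor addSn addnS addnC !exprS !mulN1r opprK.
congr (_ * \det _).
by apply/matrixP => i j; rewrite !mxE args_rcons_lift.
Qed.

Lemma jacobian_rcons x f :
  \det (jacobian_mx D (args_rcons x f)) = \sum_k inner_field x k * D k f.
Proof.
rewrite (expand_det_col _ ord_max); apply: eq_bigr => k _.
rewrite mxE args_rcons_max mulrC /inner_field /cofactor; congr (_ * \det _ * _).
by apply/matrixP => i j; rewrite !mxE !args_rcons_lift.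
Qed.

Lemma inner_derivation x : derivation (fun f => \sum_k inner_field x k * D k f).
Proof.
split=> f g.
  by rewrite -big_split; apply: eq_bigr => k _; rewrite (D_der k).1 mulrDr.
rewrite mulr_suml mulr_sumr -big_split; apply: eq_bigr => k _ /=.
by rewrite (D_der k).2 mulrDr mulrA (mulrCA f).
Qed.

(** With [X] the inner derivation of [x] and [c] its coefficients,
    [D_a (X y_b) = X (D_a y_b) + \sum_k (D_a c_k) (D_k y_b)].  Replacing in turn
    each column of the Jacobian matrix of [y] by the first summand gives
    [X (det y)], and by the second one the divergence of [c] times [det y],
    which is zero. *)
Theorem jacobian_fundamental_identity x y :
  \det (jacobian_mx D (args_rcons x (\det (jacobian_mx D y))))
    = \sum_(b < n.+1) \det (jacobian_mx D
        (args_set y b (\det (jacobian_mx D (args_rcons x (y b)))))).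
Proof.
pose X f := \sum_k inner_field x k * D k f.
pose C : 'M[A]_n.+1 := \matrix_(a, k) D a (inner_field x k).
pose Y := jacobian_mx D y.
have X_comm a f : D a (X f) = X (D a f) + \sum_k D a (inner_field x k) * D k f.
  rewrite /X derivation_sum // -big_split; apply: eq_bigr => k _ /=.
  by rewrite (D_der a).2 (D_comm a k) addrC.
have X_det : X (\det Y)
    = \sum_b \det (\matrix_(i, j) (if j == b then X (Y i j) else Y i j)).
  have X_der : derivation X by apply: inner_derivation.
  exact: (derivation_det X_der).
rewrite jacobian_rcons -/Y -/(X _) X_det.
have -> : \sum_b \det (jacobian_mx D
        (args_set y b (\det (jacobian_mx D (args_rcons x (y b))))))
  = \sum_b \det (\matrix_(i, j) (if j == b then X (Y i j) else Y i j))
    + \sum_b \det (\matrix_(i, j) (if j == b then (C *m Y) i j else Y i j)).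
  rewrite -big_split; apply: eq_bigr => b _ /=.
  rewrite jacobian_rcons det_jacobian_args_set -!(det_tr (\matrix_(i, j) _)).
  rewrite -[RHS]mul1r mulrDr; apply: (determinant_multilinear (i0 := b)).
  - apply/rowP => i; rewrite !mxE eqxx !mul1r X_comm; congr (_ + _).
    by apply: eq_bigr => k _; rewrite !mxE.
  - by apply/matrixP => i j; rewrite !mxE eq_sym (negPf (neq_lift b i)).
  - by apply/matrixP => i j; rewrite !mxE eq_sym (negPf (neq_lift b i)).
rewrite sum_det_set_col; suff -> : \tr C = 0 by rewrite mul0r addr0.
rewrite -[RHS](divergence_cofactor D_der D_comm (args_rcons x 0) ord_max).
by apply: eq_bigr => k _; rewrite mxE.
Qed.

End FundamentalIdentity.

(** * Jacobian n-Lie algebras, their quotients and square-zero extensions *)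

Section JacobianNLie.
Variables (K : fieldType) (A : comAlgType K) (n : nat).
Variable D : 'I_n.+1 -> A -> A.
Hypothesis D_der : forall i, derivation (D i).
Hypothesis D_comm : forall i j x, D i (D j x) = D j (D i x).
Hypothesis D_scale : forall i (a : K) x, D i (a *: x) = a *: D i x.

Theorem jacobian_nLie :
  is_nLie (fun f : {ffun 'I_n.+1 -> A} => \det (jacobian_mx D f)).
Proof.
split=> [f b a u v|f s|x y]; last exact: jacobian_fundamental_identity.
- rewrite !det_jacobian_args_set -!(det_tr (\matrix_(i, j) _)).
  rewrite -(mulr_algl a (\det _)) -[X in _ = _ + X]mul1r.
  apply: (determinant_multilinear (i0 := b)).
  + by apply/rowP => i; rewrite !mxE eqxx (D_der i).1 D_scale mul1r mulr_algl.
  + by apply/matrixP => i j; rewrite !mxE eq_sym (negPf (neq_lift b i)).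
  + by apply/matrixP => i j; rewrite !mxE eq_sym (negPf (neq_lift b i)).
- have -> : jacobian_mx D [ffun i => f (s i)] = col_perm s (jacobian_mx D f).
    by apply/matrixP => i j; rewrite !mxE ffunE.
  rewrite col_permE det_mulmx det_perm odd_permV mulrC scaler_sign.
  by case: (odd_perm s); rewrite ?mulN1r ?mul1r.
Qed.

End JacobianNLie.

Lemma args_setE (n : nat) (T : Type) (f : {ffun 'I_n -> T}) b u j :
  args_set f b u j = if j == b then u else f j.
Proof. by rewrite ffunE. Qed.

(** A bracket that only depends on the classes of its arguments modulo the
    kernel of a surjective map descends along this map. *)
Lemma is_nLie_quotient (K : fieldType) (n : nat) (V W : lmodType K)
    (br : {ffun 'I_n.+1 -> V} -> V) (p : V -> W) (s : W -> V) :
  is_nLie br -> linear p -> cancel s p ->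
  (forall f g : {ffun 'I_n.+1 -> V},
    (forall j, p (f j) = p (g j)) -> br f = br g) ->
  is_nLie (fun z : {ffun 'I_n.+1 -> W} => p (br [ffun j => s (z j)])).
Proof.
move=> [br_lin br_skew br_fund] p_lin sK br_p.
have p0 : p 0 = 0.
  by have := p_lin (-1) 0 0; rewrite !scaleN1r !addNr.
have pD : {morph p : u v / u + v}.
  by move=> u v; rewrite -{1}[u]scale1r p_lin scale1r.
have pZ a u : p (a *: u) = a *: p u by rewrite -[X in p X]addr0 p_lin p0 addr0.
split=> [f b a u v|f t|x y].
- rewrite -p_lin; pose g := [ffun j => s (f j)].
  have lift_set w w' : p w' = w ->
      br [ffun j => s (args_set f b w j)] = br (args_set g b w').
    by move=> pw; apply: br_p => j; rewrite !ffunE; case: eqP; rewrite sK.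
  rewrite (lift_set _ (a *: s u + s v)); last by rewrite p_lin !sK.
  by rewrite (lift_set u (s u)) ?(lift_set v (s v)) // br_lin.
- rewrite -pZ -br_skew; congr (p (br _)).
  by apply/ffunP => i; rewrite !ffunE.
- pose x' := [ffun j => s (x j)]; pose y' := [ffun j => s (y j)].
  have lift_rcons w w' : p w' = w ->
      br [ffun j => s (args_rcons x w j)] = br (args_rcons x' w').
    move=> pw; apply: br_p => j; rewrite ffunE sK.
    apply: (args_rcons_ind (P := fun w v => w = p v)) => // i.
    by rewrite ffunE sK.
  rewrite (lift_rcons _ (br y')) // br_fund (big_morph p pD p0).
  apply: eq_bigr => b _; congr p; apply: br_p => j.
  rewrite [in RHS]ffunE sK !args_setE; case: eqP => _.
    by rewrite (lift_rcons _ (y' b)) // ffunE sK.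
  by rewrite ffunE sK.
Qed.

(** The square-zero extension of [A] by itself.  The alias carries a product
    that differs from the componentwise one of [A * A]. *)
Definition dual (K : fieldType) (A : comAlgType K) : Type := (A * A)%type.

Section Dual.
Variables (K : fieldType) (A : comAlgType K).

HB.instance Definition _ := GRing.Lmodule.copy (dual A) (A * A)%type.

Definition dual_mul (u v : dual A) : dual A :=
  (u.1 * v.1, u.1 * v.2 + u.2 * v.1).

Lemma dual_mulA : associative dual_mul.
Proof. by move=> u v w; apply: injective_projections => /=; ring. Qed.

Lemma dual_mulC : commutative dual_mul.
Proof. by move=> u v; apply: injective_projections => /=; ring. Qed.

Lemma dual_mul1 : left_id ((1, 0) : dual A) dual_mul.
Proof. by case=> a m; apply: injective_projections => /=; ring. Qed.

Lemma dual_mulDl : left_distributive dual_mul +%R.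
Proof. by move=> u v w; apply: injective_projections => /=; ring. Qed.

Lemma dual_1_neq0 : ((1, 0) : dual A) != 0.
Proof. by apply/eqP => -[/eqP]; rewrite oner_eq0. Qed.

HB.instance Definition _ := GRing.Zmodule_isComNzRing.Build (dual A)
  dual_mulA dual_mulC dual_mul1 dual_mulDl dual_1_neq0.

Lemma dual_scaleAl (a : K) (u v : dual A) :
  a *: dual_mul u v = dual_mul (a *: u) v.
Proof. by apply: injective_projections; rewrite /= ?scalerDr ?scalerAl. Qed.

HB.instance Definition _ := GRing.Lmodule_isLalgebra.Build K (dual A)
  dual_scaleAl.
HB.instance Definition _ := GRing.Lalgebra_isComAlgebra.Build K (dual A).

Lemma dual_eps_mul (u v w : dual A) : u.1 = 0 -> v.1 = 0 -> u * (v * w) = 0.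
Proof.
move=> u0 v0; apply: injective_projections.
  by rewrite /= u0 mul0r.
by rewrite /= u0 v0 !mul0r mulr0 addr0.
Qed.

Definition dual_inj (a : A) : dual A := (a, 0).

Lemma dual_inj_zmod : zmod_morphism dual_inj.
Proof. by move=> a b; apply: injective_projections; rewrite /= ?subrr. Qed.

Lemma dual_inj_monoid : monoid_morphism dual_inj.
Proof.
split=> // a b; apply: injective_projections => //=.
by rewrite mulr0 mul0r addr0.
Qed.

HB.instance Definition _ := GRing.isZmodMorphism.Build A (dual A) dual_inj
  dual_inj_zmod.
HB.instance Definition _ := GRing.isMonoidMorphism.Build A (dual A) dual_inj
  dual_inj_monoid.

Definition dual_fst (u : dual A) : A := u.1.

Lemma dual_fst_zmod : zmod_morphism dual_fst.
Proof. by []. Qed.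

Lemma dual_fst_monoid : monoid_morphism dual_fst.
Proof. by []. Qed.

HB.instance Definition _ := GRing.isZmodMorphism.Build (dual A) A dual_fst
  dual_fst_zmod.
HB.instance Definition _ := GRing.isMonoidMorphism.Build (dual A) A dual_fst
  dual_fst_monoid.

End Dual.

Section JacobianModule.
Variables (K : fieldType) (A : comAlgType K) (n : nat).
Variables D D' : 'I_n.+1 -> A -> A.
Hypothesis D_der : forall i, derivation (D i).
Hypothesis D_comm : forall i j x, D i (D j x) = D j (D i x).
Hypothesis D_scale : forall i (a : K) x, D i (a *: x) = a *: D i x.
Hypothesis D'_add : forall i, {morph D' i : x y / x + y}.
Hypothesis D'_mul : forall i a m, D' i (a * m) = D i a * m + a * D' i m.
Hypothesis D'_comm : forall i j x, D' i (D' j x) = D' j (D' i x).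
Hypothesis D'_scale : forall i (a : K) x, D' i (a *: x) = a *: D' i x.

(** The derivations of [A + eps A] that extend [D] and act by [D'] on [eps A];
    for [D' = d_j] on the twist by [t^alpha] these are the derivations [d_j] of
    [A_n + t^alpha A_n], where the square of the second summand is zero. *)
Definition dual_D (i : 'I_n.+1) (z : dual A) : dual A := (D i z.1, D' i z.2).

Lemma dual_D_der i : derivation (dual_D i).
Proof.
split=> u v; apply: injective_projections => /=.
- exact: (D_der i).1.
- exact: D'_add.
- exact: (D_der i).2.
- by rewrite D'_add [u.2 * v.1]mulrC !D'_mul; ring.
Qed.

Lemma dual_D_comm i j z : dual_D i (dual_D j z) = dual_D j (dual_D i z).
Proof. by rewrite /dual_D /= D_comm D'_comm. Qed.

Lemma dual_D_scale i (a : K) (z : dual A) : dual_D i (a *: z) = a *: dual_D i z.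
Proof. by apply: injective_projections; rewrite /= ?D_scale ?D'_scale. Qed.

Variables (M : lmodType K) (p : A -> M) (s : M -> A).
Hypothesis p_lin : linear p.
Hypothesis sK : cancel s p.
Hypothesis p_ker : forall i f g, p f = p g -> D' i f = D' i g.

Let P (z : dual A) : A * M := (z.1, p z.2).
Let S (z : A * M) : dual A := (z.1, s z.2).
Let br (f : {ffun 'I_n.+1 -> dual A}) : dual A := \det (jacobian_mx dual_D f).
Let brM (z : {ffun 'I_n.+1 -> A * M}) : A * M := P (br [ffun j => S (z j)]).

Let p0 : p 0 = 0.
Proof. by have := p_lin (-1) 0 0; rewrite !scaleN1r !addNr. Qed.

Let D'_0 i : D' i 0 = 0.
Proof. by apply: (@addrI _ (D' i 0)); rewrite -D'_add !addr0. Qed.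

Let D'_s0 i : D' i (s 0) = 0.
Proof. by rewrite -[RHS](D'_0 i); apply: p_ker; rewrite sK p0. Qed.

Let br_P (f g : {ffun 'I_n.+1 -> dual A}) :
  (forall j, P (f j) = P (g j)) -> br f = br g.
Proof.
move=> fg; congr (\det _); apply: eq_jacobian_mx => i j.
by have [fg1 fg2] := fg j; rewrite /dual_D fg1 (p_ker i fg2).
Qed.

Let brM_nLie : is_nLie brM.
Proof.
apply: is_nLie_quotient; last exact: br_P.
- exact: (jacobian_nLie dual_D_der dual_D_comm dual_D_scale).
- by move=> a u v; congr (_, _); rewrite /= p_lin.
- by move=> [a m]; rewrite /P /S /= sK.
Qed.

Let br_fst f : (br f).1 = \det (jacobian_mx D (fun j => (f j).1)).
Proof.
rewrite -[(br f).1]/(dual_fst (br f)) -det_map_mx; congr (\det _).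
by apply/matrixP => i j; rewrite !mxE.
Qed.

Let S_eps (z : {ffun 'I_n.+1 -> A * M}) i j :
  (z j).1 = 0 -> dual_D i (S (z j)) = (0, D' i (s (z j).2)).
Proof. by move=> zj; rewrite /dual_D /= zj (derivation0 (D_der i)). Qed.

(** The module [M] is a quotient of [A] with the operators [D'].  The bracket
    on [A + M] is the one induced by the Jacobian bracket of the square-zero
    extension of [A]; brackets with two arguments in [M] vanish because the
    square of the ideal [M] does. *)
Theorem jacobian_module :
  is_nLie_module (fun f : {ffun 'I_n.+1 -> A} => \det (jacobian_mx D f))
    (fun x m => p (\sum_k inner_field D x k * D' k (s m))).
Proof.
exists brM; split.
- exact: brM_nLie.
- move=> x; rewrite /brM.
  have -> : br [ffun j => S ([ffun i => (x i, 0)] j)]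
      = dual_inj (\det (jacobian_mx D x)).
    rewrite -det_map_mx; congr (\det _); apply/matrixP => i j.
    by rewrite !mxE !ffunE /dual_D /= D'_s0.
  by rewrite /P /= p0.
- move=> z b zb; rewrite /brM /P /= br_fst (expand_det_col _ b) big1 // => i _.
  by rewrite mxE ffunE /= zb (derivation0 (D_der i)) mul0r.
- move=> z b c bc zb zc; rewrite /brM.
  suff -> : br [ffun j => S (z j)] = 0 by rewrite /P /= p0.
  rewrite /br -det_tr /determinant big1 // => t _.
  rewrite (bigD1 b) //= (bigD1 c) 1?eq_sym //= !mxE !ffunE !S_eps //.
  by rewrite [X in _ * X]dual_eps_mul ?mulr0.
- move=> x m; rewrite /brM.
  have -> : br [ffun j => S (args_rcons [ffun i => (x i, 0)] (0, m) j)]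
      = br (args_rcons [ffun i => dual_inj (x i)] ((0, s m) : dual A)).
    apply: br_P => j; rewrite ffunE.
    apply: (args_rcons_ind (P := fun w v => P (S w) = P v)) => [i|] /=.
      by rewrite !ffunE /P /S /= sK p0.
    by rewrite /P /S /= sK.
  rewrite /br jacobian_rcons.
  have -> : \sum_k inner_field dual_D [ffun i => dual_inj (x i)] k
        * dual_D k ((0, s m) : dual A)
      = \sum_k ((0, inner_field D x k * D' k (s m)) : dual A).
    apply: eq_bigr => k _; rewrite !inner_fieldE.
    set J := \det (row' k (\matrix_(i, j) D i (x j))).
    have -> : \det (row' k (\matrix_(i, j)
        dual_D i ([ffun i => dual_inj (x i)] j))) = dual_inj J.
      rewrite -det_map_mx; congr (\det _); apply/matrixP => i j.
      by rewrite !mxE ffunE /dual_D /= D'_0.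
    rewrite -(rmorph_sign (@dual_inj K A)) -rmorphM.
    rewrite /dual_D /= (derivation0 (D_der k)).
    by apply: injective_projections; rewrite /= ?mulr0 ?mul0r ?addr0.
  have eps_sum (F : 'I_n.+1 -> A) :
      \sum_k ((0, F k) : dual A) = (0, \sum_k F k).
    apply: injective_projections => /=.
      by rewrite (raddf_sum fst) /= big1.
    by rewrite (raddf_sum snd).
  by rewrite eps_sum.
Qed.

End JacobianModule.

(** The trivial module: [M] is a central ideal of the direct sum. *)
Lemma trivial_nLie_module (K : fieldType) (n : nat) (L M : lmodType K)
    (br : {ffun 'I_n.+1 -> L} -> L) :
  is_nLie br -> is_nLie_module br (fun _ (_ : M) => 0).
Proof.
move=> [br_lin br_skew br_fund].
have br0 (z : {ffun 'I_n.+1 -> L}) i : z i = 0 -> br z = 0.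
  move=> zi; have -> : z = args_set z i ((-1) *: 0 + 0).
    by apply/ffunP => j; rewrite ffunE scaler0 addr0; case: eqP => // ->.
  by rewrite br_lin scaleN1r addNr.
pose brM (z : {ffun 'I_n.+1 -> L * M}) : L * M := (br [ffun j => (z j).1], 0).
have pair0 (u : L) : (u, 0 : M) = 0 <-> u = 0 by split=> [[]|->].
exists brM; split=> [|x|z i|z i j _ zi _|x m].
- split=> [f i a u v|f s|x y].
  + congr (_, _); last by rewrite /= scaler0 addr0.
    pose g := [ffun j => (f j).1].
    have setE (w : L * M) : [ffun j => (args_set f i w j).1] = args_set g i w.1.
      by apply/ffunP => j; rewrite !ffunE; case: eqP.
    by rewrite /brM !setE /= br_lin.
  + congr (_, _); rewrite /= ?scaler0 // -br_skew; congr br.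
    by apply/ffunP => j; rewrite !ffunE.
  + pose x' := [ffun j => (x j).1]; pose y' := [ffun j => (y j).1].
    have rconsE (w : L * M) :
        [ffun j => (args_rcons x w j).1] = args_rcons x' w.1.
      apply/ffunP => j; rewrite ffunE.
      apply: (args_rcons_ind (P := fun w v => w.1 = v)) => // i.
      by rewrite ffunE.
    apply: injective_projections; rewrite /brM /=.
      rewrite (raddf_sum fst) /= rconsE br_fund; apply: eq_bigr => i _.
      congr br; apply/ffunP => j; rewrite !ffunE; case: eqP => // _.
      by rewrite /= rconsE.
    by rewrite (raddf_sum snd) /= big1.
- by congr (br _, _); apply/ffunP => j; rewrite !ffunE.
- by move=> zi; apply: (br0 _ i); rewrite ffunE.
- by apply/pair0; apply: (br0 _ i); rewrite ffunE.
- by congr (_, _); apply: (br0 _ ord_max); rewrite ffunE args_rcons_max.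
Qed.

(** * The derivations of the Laurent polynomials and of their twists *)

Section Laurent.
Variables (K : fieldType) (n : nat).
Local Notation laurent := (laurent K n).
Implicit Types (f g : laurent) (alpha : 'rV[K]_n) (k l : 'rV[int]_n).

Lemma sum_mcoeff (U V : zmodType) (w : {malg U['rV[int]_n]})
    (F : 'rV[int]_n -> U -> V) k :
  (forall k, F k 0 = 0) ->
  (\sum_(l <- msupp w) mono l (F l w@_l))@_k = F k w@_k.
Proof.
move=> F0; rewrite raddf_sum /=; under eq_bigr do rewrite monoE.
have [kw|kw] := boolP (k \in msupp w).
  rewrite (big_fsetD1 k) //= eqxx big1_fset ?addr0 // => l.
  by rewrite in_fsetD1 => /andP[/negbTE-> _].
rewrite big1_fset ?(mcoeff_outdom kw) ?F0 // => l lw _.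
by case: eqP kw => // <-; rewrite lw.
Qed.

Lemma laurent_ind (P : laurent -> Prop) :
  P 0 -> (forall f g, P f -> P g -> P (f + g)) ->
  (forall k c, P (mono k c)) -> forall f, P f.
Proof. by move=> P0 PD Pm f; rewrite [f]mono_sumE; apply: (big_ind P). Qed.

Lemma tderE alpha j f k : (tder alpha j f)@_k = wt alpha k 0 j * f@_k.
Proof.
rewrite tder.unlock (sum_mcoeff _ (F := fun k c => wt alpha k 0 j * c)) //.
by move=> l; rewrite mulr0.
Qed.

Lemma tder_add alpha j : {morph tder alpha j : f g / f + g}.
Proof.
by move=> f g; apply/malgP => k; rewrite mcoeffD !tderE mcoeffD mulrDr.
Qed.

Lemma tder0 alpha j : tder alpha j 0 = 0 :> laurent.
Proof. by apply/malgP => k; rewrite tderE mcoeff0 mulr0. Qed.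

Lemma tder_scale alpha j (a : K) f :
  tder alpha j (a *: f) = a *: tder alpha j f.
Proof. by apply/malgP => k; rewrite tderE !lscaleE tderE mulrCA. Qed.

Lemma tder_comm alpha i j f :
  tder alpha i (tder alpha j f) = tder alpha j (tder alpha i f).
Proof. by apply/malgP => k; rewrite !tderE mulrCA. Qed.

Lemma tder_sum alpha j (I : Type) (r : seq I) (P : pred I) (F : I -> laurent) :
  tder alpha j (\sum_(i <- r | P i) F i)
    = \sum_(i <- r | P i) tder alpha j (F i).
Proof. exact: (big_morph _ (tder_add alpha j) (tder0 alpha j)). Qed.

Lemma tder_mono alpha j k (c : K) :
  tder alpha j (mono k c : laurent) = mono k (wt alpha k 0 j * c).
Proof.
apply/malgP => l; rewrite tderE !monoE.
by case: eqP => [->|_]; rewrite ?mulr0.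
Qed.

Lemma wtD alpha k l j : wt alpha (k + l) 0 j = wt 0 k 0 j + wt alpha l 0 j.
Proof. by rewrite !mxE rmorphD /=; ring. Qed.

Lemma scale_mono (a : K) k c : a *: (mono k c : laurent) = mono k (a * c).
Proof. by apply/malgP => l; rewrite lscaleE !monoE mulrnAr. Qed.

Lemma lmul_mono k l (a b : K) :
  (mono k a : laurent) * mono l b = mono (k + l) (a * b).
Proof. exact: lmulUU. Qed.

Lemma tder_mul alpha j f g :
  tder alpha j (f * g) = dlog j f * g + f * tder alpha j g.
Proof.
rewrite /dlog; elim/laurent_ind: f => [|f f' IHf IHf'|k a].
- by rewrite tder0 !mul0r tder0 addr0.
- by rewrite mulrDl !tder_add IHf IHf' !mulrDl addrACA.
elim/laurent_ind: g => [|g g' IHg IHg'|l b].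
- by rewrite tder0 !mulr0 tder0 addr0.
- by rewrite mulrDr !tder_add IHg IHg' !mulrDr addrACA.
rewrite lmul_mono !tder_mono !lmul_mono -monoD wtD; congr mono; ring.
Qed.

Lemma dlog_der (j : 'I_n) : derivation (@dlog K n j).
Proof. by split=> f g; [exact: tder_add|exact: tder_mul]. Qed.

Definition vf_apply alpha (X : vfield K n) f : laurent :=
  \sum_i X i * tder alpha i f.

Lemma vf_apply_add alpha X : {morph vf_apply alpha X : f g / f + g}.
Proof.
move=> f g; rewrite -big_split; apply: eq_bigr => i _ /=.
by rewrite tder_add mulrDr.
Qed.

Lemma vf_apply0 alpha X : vf_apply alpha X 0 = 0.
Proof. by rewrite /vf_apply big1 // => i _; rewrite tder0 mulr0. Qed.

Lemma vf_apply_scale alpha X (a : K) f :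
  vf_apply alpha X (a *: f) = a *: vf_apply alpha X f.
Proof.
by rewrite scaler_sumr; apply: eq_bigr => i _; rewrite tder_scale scalerAr.
Qed.

Lemma vf_applyD alpha (a : K) X Y f :
  vf_apply alpha (a *: X + Y) f = a *: vf_apply alpha X f + vf_apply alpha Y f.
Proof.
rewrite scaler_sumr -big_split; apply: eq_bigr => i _ /=.
by rewrite !ffunE mulrDl scalerAl.
Qed.

Lemma vf_apply_lie alpha X Y f :
  vf_apply alpha (vf_lie X Y) f
    = vf_apply alpha X (vf_apply alpha Y f)
      - vf_apply alpha Y (vf_apply alpha X f).
Proof.
have expand Z T : vf_apply alpha Z (vf_apply alpha T f)
    = \sum_i \sum_j (Z i * dlog i (T j) * tder alpha j f)
      + \sum_i \sum_j (Z i * T j * tder alpha i (tder alpha j f)).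
  rewrite -big_split; apply: eq_bigr => i _ /=.
  rewrite tder_sum mulr_sumr -big_split.
  by apply: eq_bigr => j _ /=; rewrite tder_mul mulrDr !mulrA.
rewrite !expand [X in _ - (_ + X)]exchange_big /=.
have -> : \sum_j \sum_i Y i * X j * tder alpha i (tder alpha j f)
    = \sum_i \sum_j X i * Y j * tder alpha i (tder alpha j f).
  apply: eq_bigr => i _; apply: eq_bigr => j _.
  by rewrite tder_comm (mulrC (X i)).
rewrite opprD addrACA subrr addr0 /vf_apply /vf_lie.
under [LHS]eq_bigr => j _ do rewrite ffunE mulr_suml.
rewrite exchange_big -sumrB; apply: eq_bigr => i _ /=.
by rewrite -sumrB; apply: eq_bigr => j _; rewrite mulrBl.
Qed.

Lemma vf_apply_Dvf alpha (i : 'I_n) f :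
  vf_apply alpha (Dvf (delta_mx 0 i) 0) f = tder alpha i f.
Proof.
rewrite /vf_apply (bigD1 i) //= big1 => [|j /negPf ji].
  rewrite ffunE !mxE !eqxx scale1r addr0; exact: mul1r.
by rewrite ffunE !mxE eqxx ji scale0r mul0r.
Qed.

End Laurent.

(** * Weighted images of the twisted Laurent polynomials *)

Section WeightedMap.
Variables (K : fieldType) (n : nat) (U : lmodType K).
Local Notation laurent := (laurent K n).
Implicit Types (f : laurent) (alpha : 'rV[K]_n) (k l : 'rV[int]_n).
Variable g : 'rV[int]_n -> U.

(** Both nontrivial modules of the theorem are images of such maps: [t^k] goes
    to [t^k (x) u] for constant [g = u], and to its differential when [g k] is
    the weight of [t^k]. *)
Definition weighted_map f : tmod n U :=
  \sum_(k <- msupp f) mono k (f@_k *: g k).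

Lemma weighted_mapE f k : (weighted_map f)@_k = f@_k *: g k.
Proof.
rewrite (sum_mcoeff _ (F := fun k c => c *: g k)) // => l.
exact: scale0r.
Qed.

Lemma weighted_map_linear : linear weighted_map.
Proof.
move=> a f f'; apply/malgP => k.
by rewrite mcoeffD tmod_scaleE !weighted_mapE mcoeffD lscaleE scalerDl scalerA.
Qed.

Lemma weighted_map_mono k (c : K) : weighted_map (mono k c) = mono k (c *: g k).
Proof.
apply/malgP => l; rewrite weighted_mapE !monoE.
by case: eqP => [->|_]; rewrite ?scale0r.
Qed.

Lemma msupp_vf_supp (X : vfield K n) i : (msupp (X i) `<=` vf_supp X)%fset.
Proof. by apply: bigfcup_sup; rewrite ?mem_enum. Qed.

(** The hypothesis says that [D(u, r)] sends [t^k (x) g k] to the multiple of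
    [t^(k + r) (x) g (k + r)] whose coefficient is that of [D(u, r) t^k]. *)
Lemma T_act_weighted (rho : sl_module n U) alpha (X : vfield K n) f :
  (forall (Y : vfield K n) k r (c : K),
     (\sum_i (Y i)@_r * wt alpha k 0 i) *: (c *: g k)
       + rho (\matrix_(i, j) ((r 0 i)%:~R * (Y j)@_r)) (c *: g k)
     = ((\sum_i (Y i)@_r * wt alpha k 0 i) * c) *: g (k + r)) ->
  T_act rho alpha X (weighted_map f) = weighted_map (vf_apply alpha X f).
Proof.
move=> gP.
have w0 : weighted_map 0 = 0.
  by apply/malgP => k; rewrite weighted_mapE !mcoeff0 scale0r.
have wD : {morph weighted_map : u v / u + v}.
  by move=> u v; rewrite -{1}[u]scale1r weighted_map_linear scale1r.
pose c r k := \sum_i (X i)@_r * wt alpha k 0 i.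
have -> : vf_apply alpha X f
    = \sum_(r <- vf_supp X) \sum_(k <- msupp f) mono (k + r) (c r k * f@_k).
  rewrite /vf_apply; under eq_bigr => i _.
    have le_t : (msupp (tder alpha i f) `<=` msupp f)%fset.
      apply/fsubsetP => k; rewrite -!mcoeff_neq0 tderE.
      by apply: contra_neq => ->; rewrite mulr0.
    rewrite [X i * _](lmulw (msupp_vf_supp X i) le_t); over.
  rewrite exchange_big /=; apply: eq_bigr => r _.
  rewrite exchange_big /=; apply: eq_bigr => k _.
  rewrite mulr_suml mono_sum; apply: eq_bigr => i _.
  by rewrite tderE addrC mulrA.
rewrite T_act.unlock (big_morph _ wD w0); apply: eq_bigr => r _.
rewrite (big_morph _ wD w0) (@big_fset_incl _ _ _ _ _ (msupp f)) /=.
- by apply: eq_bigr => k _; rewrite weighted_map_mono weighted_mapE gP.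
- apply/fsubsetP => k; rewrite -!mcoeff_neq0 weighted_mapE.
  by apply: contra_neq => ->; rewrite scale0r.
- move=> k _ /mcoeff_outdom->; have := gP X k r 0.
  by rewrite scale0r mulr0 scale0r => ->; rewrite mono0.
Qed.

End WeightedMap.

(** * Modules covered by the twisted Laurent polynomials *)

(** The module [M] is the image of [t^alpha A_n] under a map [p] that commutes
    with vector fields.  The coordinates [co] separate the points of [M], and
    [p] multiplies the [k]-th coefficient by a vector [g k].  Where [g k = 0]
    the weight vanishes, so that the kernel of [p] is killed by all [d_i]. *)
Section Covered.
Variables (K : numFieldType) (n : nat) (alpha : 'rV[K]_n.+1).
Local Notation laurent := (laurent K n.+1).
Variables (M U : lmodType K) (p : laurent -> M) (co : 'rV[int]_n.+1 -> M -> U).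
Variables (g : 'rV[int]_n.+1 -> U) (act : vfield K n.+1 -> M -> M).
Implicit Types (f : laurent) (m : M) (k l : 'rV[int]_n.+1) (la : 'rV[K]_n.+1).

Hypothesis co_lin : forall k, linear (co k).
Hypothesis co_inj : forall m m', (forall k, co k m = co k m') -> m = m'.
Hypothesis co_p : forall k f, co k (p f) = f@_k *: g k.
Hypothesis p_surj : forall m, exists f, p f = m.
Hypothesis act_p : forall X f, act X (p f) = p (vf_apply alpha X f).
Hypothesis g_wt : forall k, g k = 0 -> wt alpha k = 0.

Lemma covered_p_linear : linear p.
Proof.
move=> a f f'; apply: co_inj => k.
by rewrite co_lin !co_p mcoeffD lscaleE scalerDl scalerA.
Qed.

Lemma covered_p_ker i f f' : p f = p f' -> tder alpha i f = tder alpha i f'.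
Proof.
move=> /(congr1 (co _)) ff'; apply/malgP => k; rewrite !tderE.
have := ff' k; rewrite !co_p => /eqP; rewrite -subr_eq0 -scalerBl scaler_eq0.
rewrite subr_eq0 => /orP[/eqP-> //|/eqP/g_wt->]; by rewrite mxE !mul0r.
Qed.

Lemma covered_Sn_module : is_Sn_module act.
Proof.
split=> [X a u v _|X Y a v _ _|X Y v _ _].
- have [[f <-] [f' <-]] := (p_surj u, p_surj v).
  rewrite -covered_p_linear !act_p vf_apply_add vf_apply_scale.
  exact: covered_p_linear.
- have [f <-] := p_surj v.
  by rewrite !act_p vf_applyD covered_p_linear.
- have [f <-] := p_surj v; rewrite !act_p vf_apply_lie.
  have := covered_p_linear (-1) (vf_apply alpha Y (vf_apply alpha X f))
    (vf_apply alpha X (vf_apply alpha Y f)).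
  by rewrite !scaleN1r ![- _ + _]addrC.
Qed.

Lemma covered_Sn_nLie_module :
  is_Sn_nLie_module act (fun x m => act (ad_vf x) m).
Proof.
split=> //; first exact: covered_Sn_module.
have [s sK] := choice p_surj.
have -> : (fun x m => act (ad_vf x) m) =
    (fun x m => p (\sum_k inner_field (@dlog K n.+1) x k * tder alpha k (s m))).
  apply/funext => x; apply/funext => m; rewrite -{1}[m]sK act_p; congr p.
  by apply: eq_bigr => k _; rewrite inner_fieldE ffunE.
exact: (jacobian_module (@dlog_der K n.+1) (tder_comm 0) (tder_scale 0)
  (tder_add alpha) (tder_mul alpha) (tder_comm alpha) (tder_scale alpha)
  covered_p_linear sK covered_p_ker).
Qed.

Lemma wt_inj : injective (wt alpha).
Proof.
move=> k l /addrI kl; apply/rowP => j; apply/eqP; rewrite -(eqr_int K).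
by have /rowP/(_ j) := kl; rewrite !mxE => ->.
Qed.

Lemma co_weight k i m :
  co k (act (Dvf (delta_mx 0 i) 0) m) = wt alpha k 0 i *: co k m.
Proof.
by have [f <-] := p_surj m; rewrite act_p vf_apply_Dvf !co_p tderE scalerA.
Qed.

Let coZ k (a : K) m : co k (a *: m) = a *: co k m.
Proof.
have co0 : co k 0 = 0 by have := co_lin k (-1) 0 0; rewrite !scaleN1r !addNr.
by rewrite -[a *: m]addr0 co_lin co0 addr0.
Qed.

Let coD k : {morph co k : m m' / m + m'}.
Proof. by move=> m m'; rewrite -{1}[m]scale1r co_lin scale1r. Qed.

Let co0 k : co k 0 = 0.
Proof. by rewrite -(scale0r 0) coZ scale0r. Qed.

Lemma weight_vectorP la m :
  weight_vector act la m <-> forall k, wt alpha k != la -> co k m = 0.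
Proof.
split=> [mla k|m0 i]; last first.
  apply: co_inj => k; rewrite co_weight coZ.
  by have [->|/m0->] := eqVneq (wt alpha k) la; rewrite ?scaler0.
apply: contra_neq_eq => cok; apply/rowP => i.
have := congr1 (co k) (mla i); rewrite co_weight coZ => /eqP.
by rewrite -subr_eq0 -scalerBl scaler_eq0 (negPf cok) orbF subr_eq0 => /eqP.
Qed.

(** The weights [alpha + k] are pairwise distinct, so each weight space is
    spanned by the image of at most one monomial. *)
Lemma covered_cuspidal : is_cuspidal act.
Proof.
split; first split=> [v|s c us cla].
- have [f <-] := p_surj v.
  pose h la : laurent :=
    \sum_(k <- msupp f) mono k (if wt alpha k == la then f@_k else 0).
  have hE la k : (h la)@_k = if wt alpha k == la then f@_k else 0.
    rewrite (sum_mcoeff _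
      (F := fun k c => if wt alpha k == la then c else 0)) // => l.
    by case: eqP.
  exists (undup [seq wt alpha k | k <- msupp f]), (fun la => p (h la)); split.
    move=> la; apply/weight_vectorP => k /negPf kla.
    by rewrite co_p hE kla scale0r.
  apply: co_inj => k; rewrite (big_morph _ (coD k) (co0 k)) co_p.
  under eq_bigr => la _ do rewrite co_p hE.
  have [kf|kf] := boolP (k \in msupp f); last first.
    rewrite (mcoeff_outdom kf) scale0r big1 // => la _.
    by case: eqP; rewrite scale0r.
  rewrite (bigD1_seq (wt alpha k)) ?undup_uniq ?mem_undup ?map_f //= eqxx.
  by rewrite big1 ?addr0 // => la; rewrite eq_sym => /negPf->; rewrite scale0r.
- move=> sum0 la las; apply: co_inj => k; rewrite co0.
  have cP mu := (weight_vectorP mu (c mu)).1 (cla mu).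
  have [kla|/cP //] := eqVneq (wt alpha k) la.
  have := congr1 (co k) sum0; rewrite (big_morph _ (coD k) (co0 k)) co0.
  rewrite (bigD1_seq la) //= big1 ?addr0 // => mu; rewrite eq_sym -kla.
  exact: cP.
- exists 1 => la; have [[k <-]|no_k] := pselect (exists k, wt alpha k = la).
    exists (fun=> p (mono k 1)); split=> [_|v].
      apply/weight_vectorP => l lk; rewrite co_p monoE.
      rewrite (_ : (k == l) = false) ?scale0r //.
      by apply: contra_neqF lk => /eqP->.
    have [f <-] := p_surj v => /weight_vectorP fla.
    exists (fun=> f@_k); rewrite big_ord1; apply: co_inj => l; rewrite coZ.
    have [->|kl] := eqVneq l k; first by rewrite !co_p monoE eqxx scale1r.
    rewrite fla; last by apply: contra_neq kl => /wt_inj.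
    by rewrite co_p monoE eq_sym (negPf kl) scale0r scaler0.
  exists (fun=> 0); split=> [_|v /weight_vectorP v0].
    by apply/weight_vectorP => l _; rewrite co0.
  exists (fun=> 0); rewrite big_ord1 scaler0; apply: co_inj => l.
  by rewrite co0 v0 //; apply/eqP => la_l; apply: no_k; exists l.
Qed.

End Covered.

(** * Inner derivations by monomials *)

Section InnerFieldDet.
Variables (A : comNzRingType) (n : nat) (D : 'I_n.+1 -> A -> A).

Lemma inner_field_det (x : {ffun 'I_n.+1.-1 -> A}) (w : 'I_n.+1 -> A) :
  \sum_k inner_field D x k * w k
    = \det (\matrix_(i, j)
        (if unlift ord_max j is Some j' then D i (x j') else w i)).
Proof.
rewrite (expand_det_col _ ord_max); apply: eq_bigr => k _.
rewrite mxE unlift_none mulrC /inner_field /cofactor; congr (_ * (_ * \det _)).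
by apply/matrixP => i j; rewrite !mxE args_rcons_lift liftK.
Qed.

End InnerFieldDet.

Section Monomials.
Variables (K : fieldType) (n : nat).
Local Notation laurent := (laurent K n).

Lemma prod_mono (I : finType) (v : I -> 'rV[int]_n) (c : I -> K) :
  \prod_i (mono (v i) (c i) : laurent) = mono (\sum_i v i) (\prod_i c i).
Proof.
apply: (big_rec3 (fun (F : laurent) v c => F = mono v c)) => // i F w a _ ->.
exact: lmul_mono.
Qed.

Lemma det_mono N (v : 'I_N -> 'rV[int]_n) (A : 'M[K]_N) :
  \det (\matrix_(i, j) (mono (v j) (A i j) : laurent))
    = mono (\sum_j v j) (\det A).
Proof.
rewrite /determinant mono_sum; apply: eq_bigr => s _.
have -> : \prod_i (\matrix_(i, j) (mono (v j) (A i j) : laurent)) i (s i)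
    = mono (\sum_j v j) (\prod_i A i (s i)).
  rewrite [\sum_j v j](reindex_perm s) -prod_mono.
  by apply: eq_bigr => i _; rewrite mxE.
case: (odd_perm s); rewrite ?mulN1r ?mul1r //.
by apply/malgP => k; rewrite mcoeffN !monoE mulNrn.
Qed.

End Monomials.

Lemma det_mx22 (A : comPzRingType) (B : 'M[A]_2) :
  \det B = B 0 0 * B 1 1 - B 0 1 * B 1 0.
Proof.
rewrite (expand_det_row _ 0) !big_ord_recl big_ord0 addr0.
rewrite /cofactor !det_mx11 !mxE.
rewrite /= expr0 mul1r expr1 mulN1r mulrN.
by congr (B _ _ * B _ _ - B _ _ * B _ _); apply: val_inj.
Qed.

Lemma det_two_columns (A : comPzRingType) (m : nat) (B : 'M[A]_m.+2)
    (o0 o1 : 'I_m.+2) :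
  o0 = 0%N :> nat -> o1 = 1%N :> nat ->
  (forall a b, b != o0 -> b != o1 -> B a b = (a == b)%:R) ->
  \det B = B o0 o0 * B o1 o1 - B o0 o1 * B o1 o0.
Proof.
move=> o0E o1E B1; pose B' : 'M[A]_(2 + m) := B.
have {}B1 a (b : 'I_m) : B' a (rshift 2 b) = (a == rshift 2 b)%:R.
  by apply: B1; apply/eqP => /(congr1 val) /=; rewrite ?o0E ?o1E.
rewrite -[\det B]/(\det B') -[B']submxK.
have -> : ursubmx B' = 0.
  by apply/matrixP => a b; rewrite !mxE B1 eq_lrshift.
have -> : drsubmx B' = 1%:M.
  by apply/matrixP => a b; rewrite !mxE B1 eq_rshift.
rewrite det_lblock det1 mulr1 det_mx22 !mxE.
by congr (B _ _ * B _ _ - B _ _ * B _ _); apply: val_inj; rewrite /= ?o0E ?o1E.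
Qed.

Lemma ex_perm2 (T : finType) (a b i j : T) :
  a != b -> i != j -> exists s : {perm T}, s a = i /\ s b = j.
Proof.
move=> ab ij; exists (tperm a i * tperm (tperm a i b) j)%g.
rewrite !permM tpermL; split; last by rewrite tpermL.
have bi : tperm a i b != i.
  by rewrite -[X in _ != X](tpermL a i) (inj_eq perm_inj) eq_sym.
by rewrite tpermD // eq_sym.
Qed.

Section Rotation.
Variables (K : fieldType) (m : nat) (alpha : 'rV[K]_m.+2).
Local Notation laurent := (laurent K m.+2).
Implicit Types (k l r : 'rV[int]_m.+2) (i j : 'I_m.+2).

(** Up to sign, the value at [b] of the linear form [u = r_i e_j - r_j e_i],
    which is orthogonal to [r]: the vector field [D(u, r)] multiplies a
    monomial of weight [b] by [t^r] and by this scalar. *)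
Definition minor2 (r b : 'rV[K]_m.+2) i j : K := r 0 i * b 0 j - r 0 j * b 0 i.

(** The exponents of [x] are the basis vectors other than [e_i] and [e_j],
    together with [r] minus their sum.  Their total is [r], and in the
    determinant with the weight of [t^k] as last column only the 2 x 2 minor
    with columns [r] and that weight survives. *)
Lemma ex_inner_monomial r i j : i != j ->
  exists (x : {ffun 'I_m.+2.-1 -> laurent}) (e : bool), forall k (c : K),
    vf_apply alpha (ad_vf x) (mono k c)
      = mono (k + r) ((-1) ^+ e * minor2 (map_mx intr r) (wt alpha k) i j * c).
Proof.
move=> ij; pose o0 : 'I_m.+2 := ord0; pose o1 : 'I_m.+2 := lift ord0 ord0.
have [s [s0 s1]] := @ex_perm2 _ o0 o1 i j isT ij.
(* [s] brings the rows i and j to the first two places, and [t] brings the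
   column of the module element from the last place to the second one. *)
pose t := tperm o1 ord_max.
pose e (c : 'I_m.+2) : 'rV[int]_m.+2 := delta_mx 0 c.
pose mid (c : 'I_m.+2) := (c != o0) && (c != o1).
pose v k c := if c == o0 then r - \sum_(c' | mid c') e (s c')
  else if c == o1 then k else e (s c).
have sum_v k : \sum_c v k (t c) = k + r.
  transitivity (\sum_c v k c); first by rewrite [RHS](reindex_perm t).
  rewrite (bigD1 o0) //= (bigD1 o1) //=.
  rewrite /v eqxx (_ : o1 == o0 = false) //=.
  rewrite [X in _ + (k + X)](eq_bigr (fun c => e (s c))); last first.
    by move=> c /andP[/negPf-> /negPf->].
  by rewrite addrCA subrK addrC.
pose B k : 'M[K]_m.+2 := \matrix_(a, b)
  (if b == o1 then wt alpha k 0 a else ((v k b 0 a)%:~R : K)).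
have tmax b : (t b == o1) = (b == ord_max).
  by rewrite /t -(inj_eq (@perm_inj _ t)) tpermK tpermL.
have det_B k : \det (B k) = (-1) ^+ s * minor2 (map_mx intr r) (wt alpha k) i j.
  have row_B : \det (row_perm s (B k)) = (-1) ^+ s * \det (B k).
    by rewrite row_permE det_mulmx det_perm.
  rewrite -[LHS](signrMK s) -row_B; congr (_ * _).
  have entry a b : row_perm s (B k) a b = if b == o1 then wt alpha k 0 (s a)
      else if b == o0 then (r 0 (s a))%:~R - \sum_(c | mid c) (s c == s a)%:R
      else (b == a)%:R.
    rewrite !mxE; case: ifP => // b1; rewrite /v b1; case: ifP => b0; last first.
      by rewrite mxE eqxx eq_sym (inj_eq perm_inj) eq_sym; case: eqP.
    rewrite !mxE summxE rmorphB rmorph_sum /=; congr (_ - _).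
    by apply: eq_bigr => c _; rewrite mxE eqxx eq_sym; case: eqP.
  have mid0 a : ~~ mid a -> \sum_(c | mid c) (s c == s a)%:R = 0 :> K.
    move=> a_mid; rewrite big1 // => c c_mid; rewrite (inj_eq perm_inj).
    by rewrite (negPf (contraNneq _ a_mid)) // => <-.
  rewrite (det_two_columns (o0 := o0) (o1 := o1)) //.
    by rewrite !entry /= !mid0 // !subr0 s0 s1 /minor2 !mxE [X in _ - X]mulrC.
  by move=> a b b0 b1; rewrite entry (negPf b0) (negPf b1) eq_sym.
exists [ffun c => tpow K (v 0 (t (lift ord_max c)))].
exists (odd_perm s (+) odd_perm t) => k c.
rewrite -[c in LHS]mulr1 -scale_mono vf_apply_scale mulrC -scale_mono.
congr (_ *: _).
transitivity (\det (\matrix_(a, b)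
    (mono (v k (t b)) (col_perm t (B k) a b) : laurent))).
  rewrite /vf_apply; under eq_bigr => a _ do rewrite ffunE -inner_fieldE.
  rewrite inner_field_det; congr (\det _); apply/matrixP => a b.
  rewrite !mxE tmax.
  case: unliftP => [b' ->|->].
    have nb : (lift ord_max b' == ord_max) = false.
      by rewrite eq_sym (negPf (neq_lift _ _)).
    have vt : v 0 (t (lift ord_max b')) = v k (t (lift ord_max b')).
      by rewrite /v tmax nb.
    rewrite ffunE /dlog /tpow tder_mono nb mulr1 vt; congr mono.
    by rewrite !mxE add0r.
  rewrite tder_mono eqxx mulr1 /v tmax eqxx (_ : t ord_max = o1) ?tpermR //=.
  by rewrite !mxE.
rewrite det_mono sum_v col_permE det_mulmx det_perm odd_permV det_B.
by rewrite mulrAC -signr_addb.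
Qed.

End Rotation.

(** * Subspaces stable under the inner derivations *)

Section Separation.
Variables (K : numFieldType) (m : nat).
Implicit Types (b c : 'rV[K]_m.+2) (r : 'rV[int]_m.+2).

Lemma ex_other (i : 'I_m.+2) : exists j, i != j.
Proof.
have [->|i0] := eqVneq i ord0; last by exists ord0.
by exists (lift ord0 ord0).
Qed.

(** The squares of the forms [r_i b_j - r_j b_i] determine [b] up to sign:
    [r = e_i] gives the squares of the coordinates and [r = e_i - e_j] gives
    their products. *)
Lemma minor2_separation b c :
  (forall r i j, i != j ->
     minor2 (map_mx intr r) b i j ^+ 2 = minor2 (map_mx intr r) c i j ^+ 2) ->
  c = b \/ c = - b.
Proof.
move=> bc.
have sq j : b 0 j ^+ 2 = c 0 j ^+ 2.
  have [i ji] := ex_other j; have := bc (delta_mx 0 i) i j.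
  rewrite eq_sym ji => /(_ isT); rewrite /minor2 !mxE !eqxx (negPf ji) /=.
  by rewrite !mul1r !mul0r !subr0.
have prod i j : i != j -> b 0 i * b 0 j = c 0 i * c 0 j.
  move=> ij; have := bc (delta_mx 0 i - delta_mx 0 j) i j ij.
  rewrite /minor2 !mxE !eqxx (negPf ij) (eq_sym j) (negPf ij) /=.
  rewrite subr0 sub0r rmorphN /= !mul1r !mulN1r !opprK => bc_ij.
  have polar x y : x * y = ((y + x) ^+ 2 - y ^+ 2 - x ^+ 2) / 2%:R :> K by field.
  by rewrite (polar (b 0 i)) (polar (c 0 i)) bc_ij !sq.
have [/rowP b0|/rowP/existsNP[i /eqP bi]] := pselect (b = 0).
  left; apply/rowP => j; have /eqP := sq j.
  by rewrite b0 mxE expr0n /= eq_sym sqrf_eq0 => /eqP.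
have sg j : i != j -> forall s : K,
    c 0 i = s * b 0 i -> s ^+ 2 = 1 -> c 0 j = s * b 0 j.
  move=> ij s ci s2; have := prod i j ij.
  rewrite ci -mulrA (mulrCA s) => /(mulfI _) -> //; last first.
    by move: bi; rewrite mxE.
  by rewrite mulrA -expr2 s2 mul1r.
have /eqP := sq i; rewrite eq_sym eqf_sqr => /orP[] /eqP ci.
  left; apply/rowP => j; have [<-|ij] := eqVneq i j; first by [].
  by rewrite (sg j ij 1) ?mul1r // expr1n.
right; apply/rowP => j; rewrite mxE; have [<-|ij] := eqVneq i j; first by [].
by rewrite (sg j ij (-1)) ?mulN1r // sqrrN expr1n.
Qed.

End Separation.

Section Submodules.
Variables (K : numFieldType) (m : nat) (alpha : 'rV[K]_m.+2).
Local Notation laurent := (laurent K m.+2).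
Local Notation wt := (wt alpha).
Implicit Types (f : laurent) (k l r : 'rV[int]_m.+2) (i j : 'I_m.+2).
Variable N : laurent -> Prop.
Hypothesis N_lin : forall (a : K) f f', N f -> N f' -> N (a *: f + f').
Hypothesis N0 : N 0.
Hypothesis N_inner : forall x f, N f -> N (vf_apply alpha (ad_vf x) f).

Lemma submodule_shift r i j f : i != j -> N f ->
  exists f', N f' /\
    forall k, f'@_(k + r) = minor2 (map_mx intr r) (wt k) i j * f@_k.
Proof.
move=> ij Nf; have [x [e xP]] := ex_inner_monomial alpha r ij.
exists ((-1) ^+ e *: vf_apply alpha (ad_vf x) f + 0); split.
  by apply: N_lin => //; apply: N_inner.
move=> k; rewrite addr0 lscaleE; elim/laurent_ind: {Nf} f => [|f f' IHf IHf'|l c].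
- by rewrite vf_apply0 !mcoeff0 !mulr0.
- by rewrite vf_apply_add !mcoeffD mulrDr IHf IHf' mulrDr.
rewrite xP !monoE (inj_eq (@addIr _ r)).
have [->|_] := eqVneq l k; last by rewrite !mulr0.
by rewrite !mulr1n -mulrA signrMK.
Qed.

(** The degree operators [d_i] are not inner derivations, so a submodule is not
    graded for free.  Shifting by [r] and then by [- r] gives a diagonal
    operator, whose eigenvalue is quadratic in the weight. *)
Lemma submodule_square r i j f : i != j -> N f ->
  exists f', N f' /\
    forall k, f'@_k = minor2 (map_mx intr r) (wt k) i j ^+ 2 * f@_k.
Proof.
move=> ij /(submodule_shift r ij)[f1 [Nf1 f1E]].
have [f2 [Nf2 f2E]] := submodule_shift (- r) ij Nf1.
exists ((-1) *: f2 + 0); split; first exact: N_lin.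
move=> k; rewrite addr0 lscaleE -[in LHS](addrK r k) f2E f1E /minor2 !mxE.
by rewrite !rmorphN !rmorphD /=; ring.
Qed.

(** A square minus its eigenvalue at [t^l] kills [t^l] and keeps [t^k]; this is
    repeated along the list [s]. *)
Lemma submodule_separate f k (s : seq 'rV[int]_m.+2) : N f -> f@_k != 0 ->
  exists f', [/\ N f', f'@_k != 0, forall l, f@_l = 0 -> f'@_l = 0
    & forall l, l \in s -> wt l != wt k -> wt l != - wt k -> f'@_l = 0].
Proof.
move=> Nf fk; elim: s => [|l s [f1 [Nf1 f1k f1_supp f1s]]]; first by exists f.
have [[r [i [j [ij rP]]]]|no_r] := pselect (exists r i j, i != j /\
    minor2 (map_mx intr r) (wt k) i j ^+ 2
      != minor2 (map_mx intr r) (wt l) i j ^+ 2).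
  have [f2 [Nf2 f2E]] := submodule_square r ij Nf1.
  exists ((- minor2 (map_mx intr r) (wt l) i j ^+ 2) *: f1 + f2).
  have E q : ((- minor2 (map_mx intr r) (wt l) i j ^+ 2) *: f1 + f2)@_q
      = (minor2 (map_mx intr r) (wt q) i j ^+ 2
         - minor2 (map_mx intr r) (wt l) i j ^+ 2) * f1@_q.
    by rewrite mcoeffD lscaleE f2E; ring.
  split=> [||q /f1_supp fq|q]; rewrite ?E ?mulf_neq0 ?subr_eq0 ?fq ?mulr0 //.
    exact: N_lin.
  rewrite inE => /predU1P[->|qs qk qNk]; first by rewrite subrr mul0r.
  by rewrite f1s ?mulr0.
exists f1; split=> // q; rewrite inE => /predU1P[->|]; last exact: f1s.
have same_sq r i j : i != j -> minor2 (map_mx intr r) (wt k) i j ^+ 2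
    = minor2 (map_mx intr r) (wt l) i j ^+ 2.
  by move=> ij; apply: contrapT => /eqP rP; apply: no_r; exists r, i, j.
by have [->|->] := minor2_separation same_sq; rewrite eqxx.
Qed.

Lemma submodule_isolate f k : N f -> f@_k != 0 ->
  exists f', [/\ N f', f'@_k != 0
    & forall l, f'@_l != 0 -> f@_l != 0 /\ (wt l = wt k \/ wt l = - wt k)].
Proof.
move=> Nf fk.
have [f' [Nf' f'k supp sep]] := submodule_separate (msupp f) Nf fk.
exists f'; split=> // l f'l; have fl : f@_l != 0.
  by apply: contra_neq f'l => /supp.
split=> //; apply: contrapT => /not_orP[/eqP lk /eqP lNk].
by move: f'l; rewrite sep ?eqxx // -mcoeff_neq0.
Qed.

(** The terms that squares cannot separate have opposite weights [b] and [- b];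
    after a shift by [r != 0] their weights [b + r] and [- b + r] are neither
    equal nor opposite. *)
Lemma submodule_monomial f k : N f -> f@_k != 0 -> wt k != 0 ->
  exists l, wt l != 0 /\ N (mono l 1).
Proof.
move=> Nf fk wk; have [f1 [Nf1 f1k f1P]] := submodule_isolate Nf fk.
have /existsNP[i /eqP wki] : ~ (forall i, wt k 0 i = (0 : 'rV_m.+2) 0 i).
  by move=> /rowP /eqP; rewrite (negPf wk).
rewrite [X in _ != X]mxE in wki; have [j ij] := ex_other i.
pose r : 'rV[int]_m.+2 := delta_mx 0 j.
have minor_r l : minor2 (map_mx intr r) (wt l) i j = - wt l 0 i.
  by rewrite /minor2 !mxE !eqxx (negPf ij) /= mul0r mul1r sub0r.
have [f2 [Nf2 f2E]] := submodule_shift r ij Nf1.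
have wt_r l : wt (l + r) = wt l + map_mx intr r.
  by apply/rowP => q; rewrite !mxE rmorphD addrA.
have f2k : f2@_(k + r) != 0 by rewrite f2E minor_r mulf_neq0 ?oppr_eq0.
have [f3 [Nf3 f3k f3P]] := submodule_isolate Nf2 f2k.
exists (k + r); split.
  apply: contra_neq wki => /rowP/(_ i); rewrite wt_r !mxE eqxx (negPf ij) /=.
  by rewrite addr0.
have f3_mono : f3 = mono (k + r) f3@_(k + r).
  apply/malgP => l; rewrite monoE; have [<- //|kl] := eqVneq (k + r) l.
  apply/eqP; apply: contraNT kl => /f3P[].
  rewrite -(subrK r l) f2E mulf_eq0 negb_or => /andP[_ /f1P[_ lk]] lkr.
  suff wl : wt (l - r) = wt k by rewrite (wt_inj wl).
  case: lk => // lk; case: lkr; rewrite !wt_r; first by move=> /addIr.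
  rewrite lk (opprD (wt k) (map_mx _ _)) => /addrI /rowP/(_ j).
  rewrite !mxE !eqxx /= => /eqP.
  by rewrite -addr_eq0 -(natrD _ 1 1) pnatr_eq0.
have := N_lin (f3@_(k + r))^-1 Nf3 N0.
by rewrite addr0 {2}f3_mono scale_mono mulVf.
Qed.

Lemma submodule_step k l i j : i != j ->
  minor2 (map_mx intr (l - k)) (wt k) i j != 0 -> N (mono k 1) -> N (mono l 1).
Proof.
move=> ij c0 /(submodule_shift (l - k) ij)[f [Nf fE]].
set c := minor2 _ _ _ _ in c0.
have := N_lin c^-1 Nf N0; rewrite addr0; suff -> : f = mono l c.
  by rewrite scale_mono mulVf.
apply/malgP => q; rewrite -(subrK (l - k) q) fE !monoE.
have -> : (k == q - (l - k)) = (l == q - (l - k) + (l - k)).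
  by rewrite subrK eq_sym subr_eq addrCA subrr addr0 eq_sym.
case: eqP => [lq|_]; last by rewrite mulr0.
rewrite mulr1 /c; congr (minor2 _ (wt _) _ _).
by apply: (@addIr _ (l - k)); rewrite -lq addrCA subrr addr0.
Qed.

(** A single shift by [l - k] works unless [l - k] is proportional to the weight
    of [t^k].  In that case the path passes through a monomial [t^(k + e_j)]
    with [e_j] off that line. *)
Lemma submodule_transitive k l : wt k != 0 -> wt l != 0 ->
  N (mono k 1) -> N (mono l 1).
Proof.
move=> wk wl Nk.
have [[i [j [ij c0]]]|par] := pselect (exists i j,
    i != j /\ minor2 (map_mx intr (l - k)) (wt k) i j != 0).
  exact: (submodule_step ij c0 Nk).
have {}par i j : minor2 (map_mx intr (l - k)) (wt k) i j = 0.
  have [->|ij] := eqVneq i j; first by rewrite /minor2 subrr.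
  by apply: contrapT => /eqP c0; apply: par; exists i, j.
have /existsNP[i /eqP wki] : ~ (forall i, wt k 0 i = (0 : 'rV_m.+2) 0 i).
  by move=> /rowP /eqP; rewrite (negPf wk).
rewrite [X in _ != X]mxE in wki; have [j ij] := ex_other i.
have wt_l q : wt l 0 q = wt k 0 q + (map_mx intr (l - k) : 'rV[K]_m.+2) 0 q.
  by rewrite !mxE rmorphB /=; ring.
have wli : wt l 0 i != 0.
  apply: contra_neq wl => wli; apply/rowP => q; rewrite [RHS]mxE wt_l.
  move: wli; rewrite wt_l => /eqP; rewrite addrC addr_eq0 => /eqP dki.
  have := par i q; rewrite /minor2 dki mulNr -opprD => /eqP.
  by rewrite oppr_eq0 mulrC -mulrDl mulf_eq0 (negPf wki) orbF => /eqP.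
have Nj : N (mono (k + delta_mx 0 j) 1).
  apply: (submodule_step ij _ Nk); rewrite addrC addKr /minor2 !mxE !eqxx.
  rewrite (negPf ij) /=.
  by rewrite mul0r mul1r sub0r oppr_eq0; move: wki; rewrite !mxE.
(* The minor of the second shift is that of [l - k], which is zero, plus the
   coordinate i of the weight of [t^l]. *)
apply: (submodule_step ij _ Nj); rewrite (_ : minor2 _ _ i j = wt l 0 i) //.
have := par i j; rewrite wt_l /minor2 !mxE !eqxx (negPf ij) /= => par_ij.
rewrite -[RHS]addr0 -par_ij !(rmorphB, rmorphD) /=; ring.
Qed.

End Submodules.

(** * The three families *)

Section CoveredIrreducible.
Variables (K : numFieldType) (n : nat) (alpha : 'rV[K]_n.+2).
Local Notation laurent := (laurent K n.+2).
Variables (M U : lmodType K) (p : laurent -> M) (co : 'rV[int]_n.+2 -> M -> U).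
Variables (g : 'rV[int]_n.+2 -> U) (act : vfield K n.+2 -> M -> M).

Hypothesis co_lin : forall k, linear (co k).
Hypothesis co_inj : forall m m', (forall k, co k m = co k m') -> m = m'.
Hypothesis co_p : forall k f, co k (p f) = f@_k *: g k.
Hypothesis p_surj : forall m, exists f, p f = m.
Hypothesis act_p : forall X f, act X (p f) = p (vf_apply alpha X f).
Hypothesis g_eq0 : forall k, g k = 0 <-> wt alpha k = 0.

Lemma ex_wt_neq0 : exists k, wt alpha k != 0.
Proof.
have [a0|a_neq0] := eqVneq alpha 0; last first.
  exists 0; rewrite (_ : wt alpha 0 = alpha) //.
  by apply/rowP => j; rewrite !mxE addr0.
exists (delta_mx 0 0); apply/eqP => /rowP/(_ 0).
rewrite a0 !mxE eqxx add0r => /eqP.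
by rewrite oner_eq0.
Qed.

(** A nonzero submodule pulls back to a subspace of [t^alpha A_n] that contains a
    monomial of nonzero weight, hence all of them; the monomial of weight zero,
    if there is one, is killed by [p]. *)
Lemma covered_irreducible : nLie_irreducible (fun x m => act (ad_vf x) m).
Proof.
have p_lin := covered_p_linear co_lin co_inj co_p.
have p0 : p 0 = 0 by have := p_lin (-1) 0 0; rewrite !scaleN1r !addNr.
have co0 k : co k 0 = 0 by rewrite -p0 co_p mcoeff0 scale0r.
split.
  have [k wk] := ex_wt_neq0; exists (p (mono k 1)).
  apply: contra_neq wk => /(congr1 (co k)); rewrite co0 co_p monoE eqxx scale1r.
  by move=> /g_eq0.
move=> N [N0 N_lin N_rho].
have [N_triv|] := pselect (forall m, N m -> m = 0); first by left.
move=> /existsNP[m /not_implyP[Nm m_neq0]]; right.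
have [f fm] := p_surj m; pose N' f := N (p f).
have N'_lin a f1 f2 : N' f1 -> N' f2 -> N' (a *: f1 + f2).
  by move=> Nf1 Nf2; rewrite /N' p_lin; apply: N_lin.
have N'0 : N' 0 by rewrite /N' p0.
have N'_inner x f1 : N' f1 -> N' (vf_apply alpha (ad_vf x) f1).
  by rewrite /N' -act_p; apply: N_rho.
have [k cok] : exists k, co k m <> 0.
  by apply/existsNP => m0; apply/m_neq0/co_inj => k; rewrite m0 co0.
have [l [wl Nl]] : exists l, wt alpha l != 0 /\ N' (mono l 1).
  have Nf : N' f by rewrite /N' fm.
  move: cok; rewrite -fm co_p => /eqP.
  rewrite scaler_eq0 negb_or => /andP[fk /eqP gk].
  by apply: (submodule_monomial N'_lin N'0 N'_inner Nf fk); apply/eqP => /g_eq0.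
move=> m'; have [f' <-] := p_surj m'; elim/laurent_ind: f' => [//|f1 f2|q c].
  by rewrite -[f1 in p (f1 + _)]scale1r; apply: N'_lin.
have [wq|wq] := eqVneq (wt alpha q) 0.
  rewrite (_ : p (mono q c) = 0) //; apply: co_inj => q'; rewrite co0 co_p monoE.
  by have [<-|_] := eqVneq q q'; rewrite ?scale0r // (g_eq0 q).2 // scaler0.
have := N'_lin c _ _ (submodule_transitive N'_lin N'0 N'_inner wl wq Nl) N'0.
by rewrite addr0 scale_mono mulr1.
Qed.

End CoveredIrreducible.

Section OneDimensional.
Variables (K : numFieldType) (n : nat) (M : vectType K).
Hypothesis dim_M : \dim {:M} = 1%N.

Lemma one_dim_span : exists2 u : M, u != 0 & forall v, exists c, v = c *: u.
Proof.
have [u Mu u0] : exists2 u, u \in {:M}%VS & u != 0.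
  exists (vpick {:M}); first exact: memv_pick.
  by rewrite vpick0 -dimv_eq0 dim_M.
exists u => // v; apply/vlineP; suff -> : <[u]>%VS = fullv by rewrite memvf.
by apply/eqP; rewrite eqEdim subvf dim_M dim_vline u0.
Qed.

Lemma trivial_cuspidal : is_cuspidal (fun (_ : vfield K n.+1) (_ : M) => 0).
Proof.
have wP (la : 'rV[K]_n.+1) (v : M) :
    weight_vector (fun (_ : vfield K n.+1) (_ : M) => 0) la v
      <-> (la != 0 -> v = 0).
  split=> [la_v la0|la_v i]; last first.
    by have [->|/la_v->] := eqVneq la 0; rewrite ?mxE ?scale0r ?scaler0.
  have /existsNP[i /eqP lai] : ~ (forall i, la 0 i = (0 : 'rV_n.+1) 0 i).
    by move=> /rowP /eqP; rewrite (negPf la0).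
  have /eqP := la_v i; rewrite eq_sym scaler_eq0 => /orP[|/eqP //].
  by move: lai; rewrite [X in _ != X]mxE => /negPf->.
have [u _ uP] := one_dim_span.
split; first split=> [v|s c us cla sum0 la las].
- exists [:: 0], (fun la => if la == 0 then v else 0); rewrite big_seq1 eqxx.
  by split=> // la; apply/wP => /negPf->.
- have cP mu := (wP mu (c mu)).1 (cla mu).
  have [la0|/cP //] := eqVneq la 0.
  rewrite -sum0 (bigD1_seq la) //= big1 ?addr0 // => mu; rewrite la0.
  exact: cP.
- exists 1 => la; exists (fun=> if la == 0 then u else 0).
  split=> [_|v /wP la_v].
    by apply/wP => /negPf->.
  have [c vc] := uP v; exists (fun=> c); rewrite big_ord1.
  by have [_|/la_v->] := eqVneq la 0; rewrite ?scaler0.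
Qed.

Lemma trivial_irreducible :
  nLie_irreducible (fun (_ : {ffun 'I_n.+1.-1 -> laurent K n.+1}) (_ : M) => 0).
Proof.
have [u u0 uP] := one_dim_span; split; first by exists u.
move=> N [N0 N_lin _].
have [N_triv|] := pselect (forall m, N m -> m = 0); first by left.
move=> /existsNP[v /not_implyP[Nv /eqP v0]]; right=> w.
have [[c vc] [d ->]] := (uP v, uP w); subst v.
have c0 : c != 0 by apply: contra_neq v0 => ->; rewrite scale0r.
have := N_lin (d / c) _ _ Nv N0.
by rewrite addr0 scalerA divfK.
Qed.

Lemma trivial_Sn_nLie_module :
  is_Sn_nLie_module (fun (_ : vfield K n.+1) (_ : M) => 0) (fun _ _ => 0).
Proof.
split=> //.
  by split=> *; rewrite ?scaler0 ?addr0 ?subr0.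
apply: trivial_nLie_module.
exact: (jacobian_nLie (@dlog_der K n.+1) (tder_comm 0) (tder_scale 0)).
Qed.

End OneDimensional.

Section Tensor.
Variables (K : numFieldType) (n : nat) (alpha : 'rV[K]_n.+2).
Variables (U : vectType K) (u : U).
Hypothesis u_neq0 : u != 0.
Hypothesis u_span : <[u]>%VS = fullv.
Local Notation act := (T_act (sl_trivial n.+2 U) alpha).
Local Notation p := (weighted_map (fun _ : 'rV[int]_n.+2 => u)).

Lemma tens_weighted (f : laurent K n.+2) : tens f u = p f.
Proof. by rewrite tens.unlock. Qed.

Let co (k : 'rV[int]_n.+2) (w : tmod n.+2 U) : U := w@_k.

Let co_lin k : linear (co k).
Proof. by move=> a v w; rewrite /co mcoeffD tmod_scaleE. Qed.

Let co_inj w w' : (forall k, co k w = co k w') -> w = w'.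
Proof. by move=> ww'; apply/malgP. Qed.

Let co_p k f : co k (p f) = f@_k *: u.
Proof. exact: weighted_mapE. Qed.

Let p_surj w : exists f, p f = w.
Proof.
have /choice[c cP] (k : 'rV[int]_n.+2) : exists c, w@_k = c *: u.
  by apply/vlineP; rewrite u_span memvf.
exists (\sum_(k <- msupp w) mono k (if w@_k == 0 then 0 else c k)).
apply/malgP => k; rewrite weighted_mapE.
rewrite (sum_mcoeff _ (F := fun k v => if v == 0 then 0 else c k)) => [|l].
  by case: eqP => [->|_]; rewrite ?scale0r.
by rewrite eqxx.
Qed.

Let act_p X f : act X (p f) = p (vf_apply alpha X f).
Proof. by apply: T_act_weighted => Y k r c; rewrite addr0 scalerA. Qed.

Lemma tensor_Sn_nLie_module :
  is_Sn_nLie_module act (fun x m => act (ad_vf x) m).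
Proof.
apply: (covered_Sn_nLie_module (co := co) (g := fun=> u)
  co_lin co_inj co_p p_surj act_p).
by move=> k /eqP; rewrite (negPf u_neq0).
Qed.

Lemma tensor_act x s :
  act (ad_vf x) (tens (tpow K s) u)
    = tens (\sum_(i < n.+2) (-1) ^+ (n.+2 + i.+1) * Jac i x
        * tder alpha i (tpow K s)) u.
Proof.
rewrite !tens_weighted act_p; congr (p _).
by apply: eq_bigr => i _; rewrite ffunE.
Qed.

Lemma tensor_cuspidal : is_cuspidal act.
Proof.
exact: (covered_cuspidal (co := co) (g := fun=> u)
  co_lin co_inj co_p p_surj act_p).
Qed.

Lemma tensor_irreducible :
  ~ integral alpha -> nLie_irreducible (fun x m => act (ad_vf x) m).
Proof.
move=> not_int.
apply: (covered_irreducible (co := co) (g := fun=> u)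
  co_lin co_inj co_p p_surj act_p).
move=> k; split=> [/eqP|wk]; first by rewrite (negPf u_neq0).
case: not_int; exists (- k); apply/rowP => j; have /rowP/(_ j) := wk.
by rewrite !mxE rmorphN => /eqP; rewrite addr_eq0 => /eqP.
Qed.

End Tensor.

Section Differential.
Variables (K : numFieldType) (n : nat) (alpha : 'rV[K]_n.+2).
Local Notation act := (@ddR_act K n.+2 alpha).
Local Notation laurent := (laurent K n.+2).

Lemma ddR_weighted (f : laurent) :
  ddR alpha f = weighted_map (fun k => (wt alpha k)^T) f.
Proof. exact: ddR_sumE. Qed.

Lemma sum_tens_tder (f : laurent) :
  \sum_(i < n.+2) tens (tder alpha i f) (delta_mx i 0 : 'cV_n.+2)
    = ddR alpha f :> tmod n.+2 _.
Proof.
apply/malgP => k; rewrite ddR_coef raddf_sum /=.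
under eq_bigr => i _ do rewrite tens_weighted weighted_mapE tderE.
apply/colP => j; rewrite summxE (bigD1 j) //= big1 => [|i /negPf ij].
  by rewrite !mxE eqxx addr0 mulr1 mulrC.
by rewrite !mxE eq_sym ij mulr0.
Qed.

Let co (k : 'rV[int]_n.+2) (w : ddR_image alpha) : 'cV[K]_n.+2 := (val w)@_k.

Let d_in (f : laurent) :
  weighted_map (fun k => (wt alpha k)^T) f \in in_ddR alpha.
Proof. by apply/asboolP; exists f; rewrite ddR_weighted. Qed.

Let p (f : laurent) : ddR_image alpha :=
  exist (fun w : Omega1 K n.+2 => w \in in_ddR alpha) _ (d_in f).

Let val_p f : val (p f) = weighted_map (fun k => (wt alpha k)^T) f.
Proof. by []. Qed.

Let co_lin k : linear (co k).
Proof. by move=> a v w; rewrite /co /= mcoeffD tmod_scaleE. Qed.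

Let co_inj w w' : (forall k, co k w = co k w') -> w = w'.
Proof. by move=> ww'; apply/val_inj/malgP. Qed.

Let co_p k f : co k (p f) = f@_k *: (wt alpha k)^T.
Proof. exact: weighted_mapE. Qed.

Let p_surj w : exists f, p f = w.
Proof.
have /asboolP[f wf] := valP w; exists f; apply: val_inj.
by rewrite val_p -ddR_weighted.
Qed.

(** [D(u, r)] multiplies [t^k (x) b], with [b] the weight of [t^k], by
    [u . b] and adds [t^(k + r) (x) (u . b) r]; the sum has the weight [b + r]
    of [t^(k + r)] as second factor. *)
Let act_p X f : act X (p f) = p (vf_apply alpha X f).
Proof.
apply: val_inj; rewrite val_p; apply: T_act_weighted => Y k r c.
apply/colP => i; rewrite !mxE.
set s := \sum_j _ * _; rewrite [X in _ + X](_ : _ = (r 0 i)%:~R * (s * c)).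
  by rewrite rmorphD /=; ring.
by rewrite mulr_suml mulr_sumr; apply: eq_bigr => j _; rewrite !mxE; ring.
Qed.

Let g_eq0 k : (wt alpha k)^T = 0 <-> wt alpha k = 0.
Proof.
by split=> [/(congr1 trmx)|->]; rewrite ?trmxK ?trmx0.
Qed.

Lemma differential_Sn_nLie_module :
  is_Sn_nLie_module act (fun x w => act (ad_vf x) w).
Proof.
apply: (covered_Sn_nLie_module (co := co) co_lin co_inj co_p p_surj act_p) => k.
by rewrite g_eq0.
Qed.

Lemma differential_act (x : {ffun 'I_n.+2.-1 -> laurent}) s
    (w : ddR_image alpha) :
  val w = \sum_(i < n.+2) tens (tder alpha i (tpow K s)) (delta_mx i 0) ->
  val (act (ad_vf x) w)
    = \sum_(i < n.+2) tens (tder alpha i (\sum_(k < n.+2) (-1) ^+ (n.+2 + k.+1)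
        * Jac k x * tder alpha k (tpow K s))) (delta_mx i 0).
Proof.
rewrite !sum_tens_tder => ws; have -> : w = p (tpow K s).
  by apply: val_inj; rewrite ws val_p ddR_weighted.
rewrite act_p val_p -ddR_weighted; congr (ddR alpha _).
by apply: eq_bigr => i _; rewrite ffunE.
Qed.

Lemma differential_cuspidal : is_cuspidal act.
Proof.
exact: (covered_cuspidal (co := co) co_lin co_inj co_p p_surj act_p).
Qed.

Lemma differential_irreducible : nLie_irreducible (fun x w => act (ad_vf x) w).
Proof. exact: (covered_irreducible co_lin co_inj co_p p_surj act_p g_eq0). Qed.

End Differential.

Theorem theorem8p3 (R : realType) (n : nat) (hn : (1 < n)%N)
    (alpha : 'rV[R[i]]_n) :
  [/\ forall (U : vectType R[i]) (u : U), u != 0 -> <[u]>%VS = fullv ->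
      exists rho : {ffun 'I_n.-1 -> laurent R[i] n} -> tmod n U -> tmod n U,
        [/\ is_Sn_nLie_module (T_act (sl_trivial n U) alpha) rho,
            forall (x : {ffun 'I_n.-1 -> laurent R[i] n}) (s : 'rV[int]_n),
              rho x (tens (tpow R[i] s) u)
                = tens (\sum_(i < n) (-1) ^+ (n + i.+1)
                          * Jac i x * tder alpha i (tpow R[i] s)) u,
            is_cuspidal (T_act (sl_trivial n U) alpha)
          & ~ integral alpha -> nLie_irreducible rho],
      exists rho : {ffun 'I_n.-1 -> laurent R[i] n} ->
                   ddR_image alpha -> ddR_image alpha,
        [/\ is_Sn_nLie_module (@ddR_act _ _ alpha) rho,
            forall (x : {ffun 'I_n.-1 -> laurent R[i] n}) (s : 'rV[int]_n)
                   (w : ddR_image alpha),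
              val w = \sum_(i < n)
                        tens (tder alpha i (tpow R[i] s)) (delta_mx i 0) ->
              val (rho x w)
                = \sum_(i < n)
                    tens (tder alpha i
                            (\sum_(k < n) (-1) ^+ (n + k.+1)
                               * Jac k x * tder alpha k (tpow R[i] s)))
                         (delta_mx i 0),
            is_cuspidal (@ddR_act _ _ alpha)
          & nLie_irreducible rho]
    & forall M : vectType R[i], \dim {:M} = 1%N ->
        [/\ is_Sn_nLie_module (fun (_ : vfield R[i] n) (_ : M) => 0)
              (fun (_ : {ffun 'I_n.-1 -> laurent R[i] n}) (_ : M) => 0),
            is_cuspidal (fun (_ : vfield R[i] n) (_ : M) => 0)
          & nLie_irreducible
              (fun (_ : {ffun 'I_n.-1 -> laurent R[i] n}) (_ : M) => 0)]].
Proof.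
case: n hn alpha => [|[|n]] // _ alpha; split.
- move=> U u u_neq0 u_span.
  exists (fun x m => T_act (sl_trivial n.+2 U) alpha (ad_vf x) m); split.
  + exact: (tensor_Sn_nLie_module alpha u_neq0 u_span).
  + exact: tensor_act.
  + exact: (tensor_cuspidal alpha u_span).
  + exact: (tensor_irreducible u_neq0 u_span).
- exists (fun x w => ddR_act (ad_vf x) w); split.
  + exact: differential_Sn_nLie_module.
  + exact: differential_act.
  + exact: differential_cuspidal.
  + exact: differential_irreducible.
- move=> M dim_M; split.
  + exact: trivial_Sn_nLie_module.
  + exact: trivial_cuspidal.
  + exact: trivial_irreducible.
Qed.
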